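(* Every representable subgroup of $\mathbb R$ is $\beta$-representable for every $\beta\in(0,1)$.
   Context: $\mathscr P$ denotes the set of primes. For a countable set $A\subset(0,\infty)$ let $G_A=\{t\in\mathbb R:\sum_{n\in A}\frac1n\sin^2\left(\frac{t\log n}{2}\right)<\infty\}$ (a subgroup of $\mathbb R$). For $\beta\in(0,1]$, a subgroup $G$ of $\mathbb R$ is called $\beta$-representable if $G=G_A$ for some $A\subset\mathscr P^\beta=\{p^\beta:p\in\mathscr P\}$; $1$-representable groups are called representable. Equivalently, $G$ is $\beta$-representable iff $G=\{t:\sum_{p\in B}p^{-\beta}\sin^2(\beta t\log p/2)<\infty\}$ for some $B\subset\mathscr P$. *)

(* Defs.v *)
From mathcomp Require Import all_boot all_order all_algebra.
From mathcomp Require Import all_classical all_reals all_analysis.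
Set Implicit Arguments.
Unset Strict Implicit.
Unset Printing Implicit Defensive.
Import Order.TTheory GRing.Theory Num.Theory.
Local Open Scope classical_set_scope.
Local Open Scope ring_scope.

Definition prime_powers (R : realType) (beta : R) : set R :=
  [set (p%:R : R) `^ beta | p in [set p : nat | prime p]].

(* The terms are nonnegative for A `<=` [set x | 0 < x], the only case of
   interest, so the unordered sum is the usual sum over the countable set A. *)
Definition G_ (R : realType) (A : set R) : set R :=
  [set t : R |
    (\esum_(x in A) (x^-1 * sin (t * ln x / 2) ^+ 2)%:E < +oo)%E].

(* A predicate on subgroups G of R; it is meant for beta in (0, 1]. *)
Definition beta_representable (R : realType) (beta : R) (G : set R) : Prop :=
  exists2 A : set R, A `<=` prime_powers beta & G = G_ A.

Definition representable (R : realType) (G : set R) : Prop :=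
  beta_representable 1 G.

(* Main.v *)
Require Import Defs.
From mathcomp Require Import all_boot all_order all_algebra.
From mathcomp Require Import all_classical all_reals all_analysis.
From mathcomp Require Import zify ring lra.
Import Order.TTheory GRing.Theory Num.Theory.
Import numFieldNormedType.Exports.
Local Open Scope classical_set_scope.
Local Open Scope ring_scope.

(* Let A be a set of primes with divergent sum of 1/p (otherwise G_A = R, and
   the empty set works), and write s(y) = sin^2(t y / 2).

   If every p in A could be replaced by a prime q with q^beta = p (1 + e_p) and
   the e_p^2 / p summable, we would be done, but that asks for a quantitative
   prime number theorem.  Only the qualitative fact that (x, e^c x] contains
   at least a constant times x / log x primes for every c > 0 and large x is
   used: it gives distinct primes q_n with beta log q_n - log n -> 0, without a
   rate.  The rate is bought by replacing p by large products.  Attach to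
   each p in A a finite block F_p of far away elements of A, of mass
   between 1 and 2, the blocks being disjoint, and let N be the set of all p r
   and p r u with r in F_p and u in F_r.  By
   s(x + y) <= 2 s(x) + 2 s(y) and p = (p r u) / (r u), the sum of s(log n) / n
   over N is finite iff that of s(log p) / p over A is; and on N the error
   beta log q_n - log n is as small as we wish, so B = {q_n : n in N} works.

   The prime gap statement is Erdos's deduction from Selberg's formula
     psi(x) log x + sum_(n <= x) Lambda(n) psi(x / n) = 2 x log x + O(x),
   obtained here by the Tatuzawa-Iseki inversion.  By that formula intervals
   have at most twice the expected density, and if (x, l x] has almost none,
   then (x / n, l x / n] has almost exactly twice the expected density for most
   prime powers n.  If l is almost the largest ratio of such a gap, these n
   are spaced by ratios little more than l, hence those intervals cover almost
   all scales, contradicting sum_(n <= x) Lambda(n) / n = log x + O(1). *)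

Set Implicit Arguments.
Unset Strict Implicit.
Unset Printing Implicit Defensive.

(** * The Moebius and von Mangoldt functions *)

Lemma sum_multiples (V : nmodType) (h : nat -> V) (d N : nat) : (0 < d)%N ->
  \sum_(1 <= m < (N %/ d).+1) h (d * m)%N =
  \sum_(1 <= n < N.+1 | (d %| n)%N) h n.
Proof.
move=> d0; elim: N => [|N IH]; first by rewrite div0n !big_geq.
rewrite [RHS]big_mkcond big_nat_recr //= -big_mkcond /= -IH divnS //.
case: ifP => dN; last by rewrite addr0.
rewrite big_nat_recr //=; congr (_ + h _).
by rewrite -[RHS](divnK dN) divnS // dN mulnC.
Qed.

(** Both sides run over the pairs (d, m) with d m <= N; the right one groups them by the product n =
    d m. *)
Lemma dirichlet_hyperbola (V : nmodType) (g : nat -> nat -> V) (N : nat) :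
  \sum_(1 <= d < N.+1) \sum_(1 <= m < (N %/ d).+1) g d (d * m)%N =
  \sum_(1 <= n < N.+1) \sum_(1 <= d < N.+1 | (d %| n)%N) g d n.
Proof.
under eq_big_nat => d /andP[d0 _] do rewrite (sum_multiples (g d)) // big_mkcond.
by rewrite exchange_big /=; apply: eq_bigr => n _; rewrite -big_mkcond.
Qed.

Lemma sum_divisors_widen (V : nmodType) (h : nat -> V) (n M N : nat) :
  (0 < n <= M)%N -> (M <= N)%N ->
  \sum_(1 <= d < N.+1 | (d %| n)%N) h d = \sum_(1 <= d < M.+1 | (d %| n)%N) h d.
Proof.
move=> /andP[n0 nM] MN; rewrite (@big_cat_nat _ _ _ M.+1) //=.
rewrite [X in _ + X]big_nat_cond [X in _ + X]big_pred0 ?addr0 // => d.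
apply/negP => /andP[/andP[Md _] /(dvdn_leq n0)]; lia.
Qed.

(** The test on [logn] is squarefreeness. The junk value at 0 is 1, but all sums below start at
    1. *)
Definition mobius (n : nat) : int :=
  if all (fun p => logn p n == 1)%N (primes n) then (-1) ^+ size (primes n) else 0.

Lemma mobius_mul_dvd p e : prime p -> (p %| e)%N -> (0 < e)%N ->
  mobius (p * e) = 0.
Proof.
move=> pp pe e0; rewrite /mobius.
have p0 := prime_gt0 pp.
case: ifP => // /allP /(_ p).
rewrite primesM // primes_prime // inE eqxx /= => /(_ isT).
rewrite lognM // logn_prime // eqxx.
have := logn_gt0 p e; rewrite mem_primes pp e0 pe /=; lia.
Qed.

Lemma mobius_mul_coprime p e : prime p -> ~~ (p %| e)%N -> (0 < e)%N ->
  mobius (p * e) = - mobius e.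
Proof.
move=> pp pe e0; have p0 := prime_gt0 pp.
have perm : perm_eq (primes (p * e)) (p :: primes e).
  apply: uniq_perm; rewrite ?primes_uniq //= ?mem_primes ?(negbTE pe) ?andbF //.
    by rewrite primes_uniq.
  by move=> q; rewrite primesM // primes_prime // !inE.
rewrite /mobius (perm_all _ perm) (perm_size perm) /= lognM // logn_prime // eqxx.
have -> : logn p e = 0%N.
  by apply/eqP; rewrite -leqn0 leqNgt logn_gt0 mem_primes (negbTE pe) !andbF.
rewrite /=.
rewrite (_ : all _ (primes e) = all (fun q => logn q e == 1)%N (primes e)).
  by case: ifP => _; rewrite ?oppr0 // exprS mulN1r.
apply: eq_in_all => q; rewrite mem_primes => /and3P[pq _ qe].
rewrite lognM // logn_prime //.
by have /negbTE-> : q != p by apply: contraNneq pe => <-.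
Qed.

Lemma normr_mobius_le1 n : `|mobius n| <= 1.
Proof.
by rewrite /mobius; case: ifP => _; rewrite ?normr0 // normrX normrN1 expr1n.
Qed.

(* Divisors divisible by p = pdiv n cancel against the others. *)
Lemma sum_mobius (n N : nat) : (0 < n <= N)%N ->
  \sum_(1 <= d < N.+1 | (d %| n)%N) mobius d = (n == 1)%:R.
Proof.
move=> nN; have /andP[n0 _] := nN.
have [->|n1] := eqVneq n 1%N.
  rewrite (@sum_divisors_widen _ _ _ 1) //; last by lia.
  by rewrite big_mkcond big_nat1.
rewrite (@sum_divisors_widen _ _ _ n) ?n0 ?leqnn //; last by lia.
have pp : prime (pdiv n) by apply: pdiv_prime; lia.
set p := pdiv n in pp; have pn : (p %| n)%N := pdiv_dvd n.
have p0 := prime_gt0 pp.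
rewrite (bigID (fun d => p %| d)%N) /=.
have -> : \sum_(1 <= d < n.+1 | (d %| n)%N && (p %| d)%N) mobius d =
   \sum_(1 <= e < (n %/ p).+1) (if (p * e %| n)%N then mobius (p * e) else 0).
  rewrite (@sum_multiples _ (fun k => if (k %| n)%N then mobius k else 0)) //.
  rewrite big_mkcond [RHS]big_mkcond; apply: eq_bigr => d _.
  by case: (d %| n)%N; case: (p %| d)%N.
have -> : \sum_(1 <= d < n.+1 | (d %| n)%N && ~~ (p %| d)%N) mobius d =
   \sum_(1 <= e < (n %/ p).+1) (if (p * e %| n)%N then - mobius (p * e) else 0).
  have le : (n %/ p <= n)%N by apply: leq_div.
  rewrite (@big_cat_nat _ _ _ (n %/ p).+1) //=.
  have key d : (d %| n)%N -> ~~ (p %| d)%N -> (p * d %| n)%N.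
    by move=> dn pd; rewrite Gauss_dvd ?pn ?dn // prime_coprime.
  rewrite [X in _ + X]big_nat_cond [X in _ + X]big_pred0 ?addr0 => [|d]; last first.
    apply/negP => /andP[/andP[Md _] /andP[dn pd]].
    have := dvdn_leq n0 (key _ dn pd).
    by rewrite mulnC -leq_divRL //; lia.
  rewrite big_mkcond /=; apply: eq_big_nat => e /andP[e0 _].
  have [pe|pe] := boolP (p %| e)%N; rewrite ?andbF ?andbT /=.
    by rewrite mobius_mul_dvd // oppr0 if_same.
  rewrite mobius_mul_coprime // opprK.
  have [en|en] := boolP (e %| n)%N; first by rewrite key.
  by case: ifP => // /(dvdn_trans (dvdn_mull p (dvdnn e))); rewrite (negbTE en).
by rewrite -big_split /= big1 // => e _; case: ifP; rewrite ?addr0 // subrr.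
Qed.

Section vonMangoldt.
Variable R : realType.
Implicit Types n N p k : nat.

(** This is ln p at a power p^k with k >= 1 and 0 elsewhere: at most one term is nonzero, and the
    ranges lose nothing because p <= p^k and k < p^k. *)
Definition Lambda n : R :=
  \sum_(1 <= p < n.+1 | prime p) \sum_(1 <= k < n.+1) (n == p ^ k)%N%:R * ln p%:R.

Lemma ln_nat_ge0 n : 0 <= ln (n%:R : R).
Proof.
case: n => [|n]; first by rewrite ln0.
by apply: ln_ge0; rewrite ler1n.
Qed.

Lemma Lambda_ge0 n : 0 <= Lambda n.
Proof.
apply: sumr_ge0 => p _; apply: sumr_ge0 => k _; apply: mulr_ge0 => //.
exact: ln_nat_ge0.
Qed.

Lemma Lambda0 : Lambda 0 = 0. Proof. by rewrite /Lambda big_geq. Qed.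

Lemma Lambda_widen n N : (n <= N)%N ->
  Lambda n =
  \sum_(1 <= p < N.+1 | prime p) \sum_(1 <= k < N.+1) (n == p ^ k)%N%:R * ln p%:R.
Proof.
move=> nN; rewrite (@big_cat_nat _ _ _ n.+1) //= [X in _ = _ + X]big_nat_cond.
rewrite [X in _ = _ + X]big1 ?addr0 => [|p /andP[/andP[np pN] pp]].
  rewrite /Lambda; apply: eq_bigr => p pp.
  rewrite [RHS](@big_cat_nat _ _ _ n.+1) //=.
  rewrite [X in _ = _ + X]big_nat_cond [X in _ = _ + X]big1 ?addr0 //.
  move=> k /andP[/andP[nk kN] _]; rewrite [n == _](_ : _ = false) ?mul0r //.
  have := ltn_expl k (prime_gt1 pp); lia.
rewrite big_nat_cond big1 // => k /andP[/andP[k0 _] _].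
rewrite [n == _](_ : _ = false) ?mul0r //.
have : (p ^ 1 <= p ^ k)%N by rewrite leq_pexp2l // prime_gt0.
rewrite expn1; lia.
Qed.

Lemma ln_primefact n : (0 < n)%N ->
  ln (n%:R : R) = \sum_(1 <= p < n.+1 | prime p) (logn p n)%:R * ln p%:R.
Proof.
move=> n0.
have lnprod (r : seq nat) (F : nat -> nat) : (forall i, (0 < F i)%N) ->
    ln ((\prod_(i <- r) F i)%N%:R : R) = \sum_(i <- r) ln (F i)%:R.
  move=> F0; elim: r => [|a r IH]; first by rewrite !big_nil ln1.
  rewrite !big_cons natrM lnM ?IH // posrE ltr0n //.
  by rewrite prodn_gt0.
rewrite -{1}(partnT n0) /partn lnprod; last by move=> i; apply: pfactor_gt0.
rewrite big_ltn // [ln (0 ^ _)%:R](_ : _ = 0) ?add0r ?ln1 //.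
rewrite [RHS]big_mkcond; apply: eq_bigr => p _.
case: ifP => pp; last by rewrite /logn pp expn0 ln1.
by rewrite natrX lnXn ?ltr0n ?prime_gt0 // mulr_natl.
Qed.

Lemma sum_Lambda n N : (0 < n <= N)%N ->
  \sum_(1 <= d < N.+1 | (d %| n)%N) Lambda d = ln n%:R.
Proof.
move=> nN; have /andP[n0 _] := nN.
rewrite (@sum_divisors_widen _ _ _ n) ?n0 ?leqnn //; last by lia.
rewrite big_nat_cond.
under eq_bigr => d /andP[/andP[_ dn] _] do rewrite (@Lambda_widen d n) //.
rewrite -big_nat_cond exchange_big /= ln_primefact //; apply: eq_bigr => p pp.
(* [logn p n] counts the exponents k < n with p^k | n, each coming from the single divisor d = p^k.
   The extra term k = n is split off and vanishes since p^n > n. *)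
rewrite exchange_big /= logn_count_dvd //.
rewrite natr_sum mulr_suml [LHS]big_nat_recr //= [X in _ + X]big1 ?addr0.
  rewrite big_nat_cond [RHS]big_nat_cond; apply: eq_bigr => k /andP[/andP[k0 kn] _].
  have [pkn|pkn] := boolP (p ^ k %| n)%N; last first.
    rewrite mul0r big1 // => d dn; case: eqP => [dE|_]; rewrite ?mul0r //.
    by rewrite -dE dn in pkn.
  rewrite big_mkcond (bigD1_seq (p ^ k)%N) ?iota_uniq ?mem_index_iota //=; last first.
    by rewrite expn_gt0 prime_gt0 // ltnS dvdn_leq.
  rewrite pkn eqxx big1 ?addr0 // => d /negbTE ->.
  by rewrite mul0r if_same.
move=> d dn; rewrite [d == _](_ : _ = false) ?mul0r //.
have := ltn_expl n (prime_gt1 pp); have := dvdn_leq n0 dn; lia.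
Qed.

Lemma Lambda_le_ln n : Lambda n <= ln n%:R.
Proof.
case: n => [|n]; first by rewrite Lambda0 ln0.
rewrite -(@sum_Lambda n.+1 n.+1) ?leqnn //.
rewrite [leRHS]big_mkcond big_nat_recr //= dvdnn lerDr.
by apply: sumr_ge0 => d _; case: ifP => // _; apply: Lambda_ge0.
Qed.

(** Write L - ln d = (L - ln n) + ln (n / d) and expand ln (n / d) as the sum of [Lambda e] over e |
    n / d. After exchanging the sums, [sum_mobius] at n / e leaves only e = n. *)
Lemma sum_mobius_ln n N (L : R) : (0 < n <= N)%N ->
  \sum_(1 <= d < N.+1 | (d %| n)%N) (mobius d)%:~R * (L - ln d%:R) =
  (n == 1)%:R * L + Lambda n.
Proof.
move=> nN; have /andP[n0 nN'] := nN.
have dvdM d e : (d * e %| n)%N = (d %| n)%N && (e %| n %/ d)%N.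
  have [dn|dn] := boolP (d %| n)%N; last first.
    by apply/negP => /(dvdn_trans (dvdn_mulr e (dvdnn d))); apply/negP.
  by rewrite dvdn_divRL // mulnC.
have muE m : (0 < m <= N)%N ->
    \sum_(1 <= d < N.+1 | (d %| m)%N) (mobius d)%:~R = (m == 1)%:R :> R.
  by move=> mN; rewrite -(rmorph_sum intr) sum_mobius //; case: (m == 1)%N.
transitivity (\sum_(1 <= d < N.+1 | (d %| n)%N) ((mobius d)%:~R * (L - ln n%:R)
    + \sum_(1 <= e < N.+1) if (d * e %| n)%N then (mobius d)%:~R * Lambda e else 0)).
  rewrite big_nat_cond [RHS]big_nat_cond.
  apply: eq_bigr => d /andP[/andP[d0 _] dn].
  rewrite (eq_bigr (fun e => if (e %| n %/ d)%N then
      (mobius d)%:~R * Lambda e else 0)) => [|e _]; last by rewrite dvdM dn.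
  rewrite -big_mkcond -mulr_sumr sum_Lambda; last first.
    by rewrite divn_gt0 // dvdn_leq //= (leq_trans (leq_div _ _)).
  have -> : ln (n%:R : R) = ln (n %/ d)%:R + ln d%:R.
    rewrite -[in LHS](divnK dn) natrM lnM // posrE ltr0n //.
    by rewrite divn_gt0 // dvdn_leq.
  ring.
rewrite big_split /= -mulr_suml muE //; congr (_ + _).
  by case: eqP => [->|_]; rewrite ?mul0r // ln1 subr0.
rewrite big_mkcond; under eq_bigr => d _.
  rewrite (_ : (if _ then _ else _) = \sum_(1 <= e < N.+1)
      if (e * d %| n)%N then (mobius d)%:~R * Lambda e else 0); last first.
    case: ifP => dn; first by apply: eq_bigr => e _; rewrite mulnC.
    by rewrite big1 // => e _; rewrite mulnC dvdM dn.
  over.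
rewrite exchange_big /= (bigD1_seq n) ?mem_index_iota ?iota_uniq //=.
rewrite [X in _ + X]big_nat_cond [X in _ + X]big1 ?addr0 => [|e /andP[/andP[e0 eN] en]].
  under eq_bigr do rewrite dvdM dvdnn divnn n0 /=.
  by rewrite -big_mkcond -mulr_suml muE ?eqxx ?mul1r //; lia.
under eq_bigr do rewrite dvdM.
have [ben|ben] /= := boolP (e %| n)%N; last by rewrite big1.
have ne0 : (0 < n %/ e)%N by rewrite divn_gt0 // dvdn_leq.
rewrite -big_mkcond -mulr_suml muE; last first.
  by rewrite ne0 (leq_trans (leq_div _ _)).
case: eqP => [ne1|_]; rewrite ?mul0r //.
by move: en; rewrite -(divnK ben) ne1 mul1n eqxx.
Qed.

End vonMangoldt.

(** * Estimates of Chebyshev and Mertens *)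

Section elementary_estimates.
Variable R : realType.
Implicit Types n m N d k : nat.
Local Notation Lambda := (@Lambda R).

Definition chebyshev_psi N : R := \sum_(1 <= n < N.+1) Lambda n.
Definition ln_fact N : R := \sum_(1 <= n < N.+1) ln n%:R.
Definition harmonic_sum N : R := \sum_(1 <= n < N.+1) n%:R^-1.
Definition mertens_sum N : R := \sum_(1 <= n < N.+1) Lambda n / n%:R.
Local Notation psi := chebyshev_psi.

Lemma ln_succ_bounds n : (0 < n)%N ->
  n.+1%:R^-1 <= ln (n.+1%:R : R) - ln (n%:R : R) <= n%:R^-1.
Proof.
move=> n0; have n0' : 0 < n%:R :> R by rewrite ltr0n.
have n1' : 0 < n.+1%:R :> R by rewrite ltr0n.
have nE : n.+1%:R = n%:R + 1 :> R by rewrite -natr1.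
apply/andP; split.
  rewrite -lerN2 opprB -ln_div // (_ : n%:R / _ = 1 + - n.+1%:R^-1); last first.
    by rewrite nE; field; rewrite -nE lt0r_neq0.
  apply: le_ln1Dx; rewrite ltrN2 invf_lt1 // ltr1n; lia.
rewrite -ln_div // (_ : _ / n%:R = 1 + n%:R^-1); last first.
  by rewrite nE; field; rewrite lt0r_neq0.
by apply: le_ln1Dx; apply: lt_trans (_ : 0 < _); rewrite ?invr_gt0 // ltrN10.
Qed.

(** A weak Stirling formula by induction: ln (n + 1) - ln n lies between 1 / (n + 1) and 1 / n. *)
Lemma ln_fact_bounds n : (0 < n)%N ->
  n%:R * ln n%:R - n%:R <= ln_fact n <= n%:R * ln n%:R - n%:R + 1 + ln n%:R.
Proof.
elim: n => // n IH _; have [->|n0] := posnP n.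
  by rewrite /ln_fact big_nat1 ln1; lra.
have /andP[lo up] := IH n0.
have /andP[d1 d2] := ln_succ_bounds n0.
rewrite /ln_fact big_nat_recr //= -/(ln_fact n).
have n0' : 0 < n%:R :> R by rewrite ltr0n.
have nE : n.+1%:R = n%:R + 1 :> R by rewrite -natr1.
set u := ln n.+1%:R in d1 d2 *; set v := ln n%:R in d1 d2 lo up *.
have e1 : n%:R * (u - v) <= 1 by rewrite mulrC -ler_pdivlMr ?div1r.
have e2 : 1 <= (n%:R + 1) * (u - v).
  by rewrite mulrC -ler_pdivrMr ?div1r -?nE // ltr0n.
rewrite nE; apply/andP; split; nra.
Qed.

Lemma sum_swap_hyperbola (f : nat -> nat -> R) N :
  \sum_(1 <= m < N.+1) \sum_(1 <= k < (N %/ m).+1) f m k =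
  \sum_(1 <= k < N.+1) \sum_(1 <= m < (N %/ k).+1) f m k.
Proof.
have widen (g : nat -> R) m : (0 < m)%N -> \sum_(1 <= k < (N %/ m).+1) g k =
    \sum_(1 <= k < N.+1) if (m * k <= N)%N then g k else 0.
  move=> m0; rewrite (big_nat_widen _ _ N.+1) ?ltnS ?leq_div //=.
  by rewrite big_mkcond; apply: eq_bigr => k _; rewrite ltnS leq_divRL // mulnC.
rewrite big_nat [RHS]big_nat.
under eq_bigr => m /andP[m0 _] do rewrite widen //.
under [RHS]eq_bigr => m /andP[m0 _] do rewrite widen //.
rewrite -!big_nat exchange_big /=; apply: eq_bigr => k _.
by apply: eq_bigr => m _; rewrite mulnC.
Qed.

Lemma sum_Lambda_divn N : \sum_(1 <= n < N.+1) Lambda n * (N %/ n)%:R = ln_fact N.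
Proof.
rewrite /ln_fact; transitivity (\sum_(1 <= d < N.+1)
    \sum_(1 <= m < (N %/ d).+1) Lambda d).
  apply: eq_bigr => d _; rewrite sumr_const_nat subSS subn0 mulr_natr //.
rewrite (dirichlet_hyperbola (fun d _ => Lambda d)).
rewrite big_nat [RHS]big_nat; apply: eq_bigr => n /andP[n0 nN].
by rewrite sum_Lambda // n0.
Qed.

Lemma sum_psi_divn N : \sum_(1 <= m < N.+1) psi (N %/ m) = ln_fact N.
Proof.
rewrite (sum_swap_hyperbola (fun _ k => Lambda k)) -sum_Lambda_divn.
by apply: eq_bigr => d _; rewrite sumr_const_nat subSS subn0 mulr_natr.
Qed.

Lemma psi_ge0 N : 0 <= psi N.
Proof. by apply: sumr_ge0 => n _; apply: Lambda_ge0. Qed.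

Lemma psiB m n : (m <= n)%N -> psi n - psi m = \sum_(m.+1 <= k < n.+1) Lambda k.
Proof. by move=> mn; rewrite /psi (@big_cat_nat _ _ _ m.+1) //= addrAC subrr add0r. Qed.

Lemma le_psi : {homo psi : m n / (m <= n)%N >-> m <= n}.
Proof.
move=> m n mn; rewrite -subr_ge0 psiB //; apply: sumr_ge0 => k _.
exact: Lambda_ge0.
Qed.

(* N %/ n - 2 * (N %/ 2 %/ n) is nonnegative, and it is 1 for N / 2 < n <= N. *)
Lemma psi_half N : (0 < N)%N -> psi N - psi (N %/ 2) <= 5 * N%:R.
Proof.
move=> N0; have [N1|N2] := leqP N 1.
  have -> : N = 1%N by lia.
  rewrite /psi big_nat1 big_geq // subr0 (le_trans (Lambda_le_ln _ _)) // ln1.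
  by rewrite mulr_ge0.
set m := (N %/ 2)%N; have m0 : (0 < m)%N by rewrite /m; lia.
apply: (@le_trans _ _ (ln_fact N - 2 * ln_fact m)).
  rewrite -!sum_Lambda_divn psiB ?leq_div //.
  have -> : \sum_(1 <= n < m.+1) Lambda n * (m %/ n)%:R =
      \sum_(1 <= n < N.+1) Lambda n * (m %/ n)%:R.
    rewrite [RHS](@big_cat_nat _ _ _ m.+1) ?ltnS ?leq_div //=.
    rewrite [X in _ + X]big_nat [X in _ + X]big1 ?addr0 // => i /andP[mi _].
    by rewrite divn_small // mulr0.
  rewrite mulr_sumr -sumrB [leRHS](@big_cat_nat _ _ _ m.+1) ?ltnS ?leq_div //=.
  rewrite -[leLHS]add0r lerD //.
    apply: sumr_ge0 => i _; rewrite mulrCA -mulrBr mulr_ge0 ?Lambda_ge0 //.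
    rewrite subr_ge0 -natrM ler_nat; case: i => [|i]; rewrite ?divn0 //.
    rewrite leq_divRL // mulnAC -mulnA [X in (_ <= X)%N](divn_eq N 2) mulnC -/m.
    by have := leq_divM m i.+1; lia.
  rewrite big_nat [leRHS]big_nat; apply: ler_sum => i /andP[mi iN].
  rewrite [(m %/ i)%N]divn_small // mulr0 mulr0 subr0 ler_peMr ?Lambda_ge0 //.
  by rewrite ler1n divn_gt0; lia.
have /andP[_ up] := ln_fact_bounds N0.
have /andP[lo _] := ln_fact_bounds m0.
have N0' : 0 < N%:R :> R by rewrite ltr0n.
have m0' : 0 < m%:R :> R by rewrite ltr0n.
have h1 : 2 * m%:R <= N%:R :> R by rewrite -natrM ler_nat /m; lia.
have h2 : N%:R <= 2 * m%:R + 1 :> R by rewrite -natrM natr1 ler_nat /m; lia.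
have h3 : ln N%:R - ln m%:R <= 2 :> R.
  rewrite -ln_div ?posrE // (_ : _ / _ = 1 + (N%:R / m%:R - 1)); last by ring.
  have : N%:R / m%:R <= 3 :> R by rewrite ler_pdivrMr // -natrM ler_nat /m; lia.
  have : 0 < N%:R / m%:R :> R by rewrite divr_gt0.
  move=> ? ?; apply: (le_trans (le_ln1Dx _)); lra.
have h4 : ln N%:R <= N%:R :> R by apply/ltW/ln_sublinear.
have h5 : ln m%:R <= m%:R :> R by apply/ltW/ln_sublinear.
have h6 : 0 <= ln m%:R :> R by apply: ln_nat_ge0.
have h7 : 1 <= N%:R :> R by rewrite ler1n.
nra.
Qed.

(** Chebyshev's bound: iterating [psi_half] sums 5 (1 + 1/2 + 1/4 + ...) = 10. *)
Lemma psi_le N : psi N <= 10 * N%:R.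
Proof.
elim/ltn_ind: N => N IH; have [->|N0] := posnP N.
  by rewrite /psi big_geq // mulr0.
have := psi_half N0; have : (N %/ 2 < N)%N by lia.
move=> /IH; have : 2 * (N %/ 2)%:R <= N%:R :> R by rewrite -natrM ler_nat; lia.
lra.
Qed.

(** [ln_fact N] is the sum of Lambda(n) floor(N / n); dropping the floor costs at most psi(N) =
    O(N), and dividing by N gives Mertens' estimate. *)
Lemma mertens_bounds N : (0 < N)%N ->
  ln N%:R - 1 <= mertens_sum N <= ln N%:R + 11.
Proof.
move=> N0; have N0' : 0 < N%:R :> R by rewrite ltr0n.
have N1 : 1 <= N%:R :> R by rewrite ler1n.
have /andP[lo up] := ln_fact_bounds N0.
have S1 : ln_fact N <= N%:R * mertens_sum N.
  rewrite -sum_Lambda_divn mulr_sumr big_nat [leRHS]big_nat.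
  apply: ler_sum => n /andP[n0 nN]; rewrite mulrCA ler_wpM2l ?Lambda_ge0 //.
  by rewrite ler_pdivlMr ?ltr0n // -natrM ler_nat leq_divM.
have S2 : N%:R * mertens_sum N <= ln_fact N + psi N.
  rewrite -sum_Lambda_divn -big_split /= mulr_sumr [leLHS]big_nat [leRHS]big_nat.
  apply: ler_sum => n /andP[n0 nN] /=; rewrite mulrCA -[X in _ + X]mulr1 -mulrDr.
  rewrite ler_wpM2l ?Lambda_ge0 // ler_pdivrMr ?ltr0n // natr1 -natrM ler_nat.
  by rewrite ltnW // ltn_ceil.
have ps := psi_le N.
have lnle : ln N%:R <= N%:R - 1 :> R.
  rewrite -[X in ln X](subrKC 1); apply: le_ln1Dx; lra.
by apply/andP; split; rewrite -(ler_pM2l N0'); lra.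
Qed.

(** H_k - ln (k + 1) increases with k >= 1 and stays below the decreasing H_k - ln k, so this
    supremum is the common limit, Euler's constant. *)
Definition euler_gamma : R :=
  sup [set harmonic_sum n.+1 - ln n.+2%:R | n in [set: nat]].

Lemma harmonic_bounds n : (0 < n)%N ->
  ln n%:R + euler_gamma <= harmonic_sum n <= ln n%:R + euler_gamma + n%:R^-1.
Proof.
pose u k : R := harmonic_sum k - ln k%:R.
pose v k : R := harmonic_sum k - ln k.+1%:R.
have HS k : harmonic_sum k.+1 = harmonic_sum k + k.+1%:R^-1.
  by rewrite /harmonic_sum big_nat_recr.
have uS k : (0 < k)%N -> u k.+1 <= u k.
  move=> /ln_succ_bounds /andP[a _]; rewrite /u HS.
  by move: a; move: (ln _) (ln _) (_^-1) => x y z; lra.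
have vS k : v k <= v k.+1.
  have /andP[_ b] := @ln_succ_bounds k.+1 isT; rewrite /v HS.
  by move: b; move: (ln _) (ln _) (_^-1) => x y z; lra.
have vu k : (0 < k)%N -> v k <= u k.
  move=> k0; have /andP[a _] := ln_succ_bounds k0; rewrite /u /v.
  have : 0 <= k.+1%:R^-1 :> R by rewrite invr_ge0.
  by move: a; move: (ln _) (ln _) (_^-1) => x y z; lra.
have umono k j : (0 < k)%N -> u (k + j)%N <= u k.
  move=> k0; elim: j => [|j IH]; rewrite ?addn0 // addnS.
  by apply: le_trans IH; apply: uS; lia.
have vmono k j : v k <= v (k + j)%N.
  elim: j => [|j IH]; rewrite ?addn0 // addnS.
  exact: le_trans IH (vS _).
have vleu k j : (0 < k)%N -> v j <= u k.
  move=> k0; apply: le_trans (vmono j k) _.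
  by rewrite addnC; apply: le_trans (umono k j k0); apply: vu; lia.
move=> n0; have hs : has_sup [set v k.+1 | k in [set: nat]].
  split; first by exists (v 1%N), 0%N.
  by exists (u n) => _ [k _ <-]; apply: vleu.
have g1 : euler_gamma <= u n.
  by apply: ge_sup => [|_ [k _ <-]]; [exists (v 1%N), 0%N | apply: vleu].
have g2 : v n <= euler_gamma.
  by apply: sup_ubound; [case: hs | exists n.-1; rewrite // prednK].
have /andP[_ b] := ln_succ_bounds n0.
move: g1 g2; rewrite /u /v => g1 g2; apply/andP; split; lra.
Qed.

Lemma euler_gamma_bounds : 0 <= euler_gamma <= 1.
Proof.
have := @harmonic_bounds 1 isT; rewrite /harmonic_sum big_nat1 ln1 invr1; lra.
Qed.

End elementary_estimates.

(** * Selberg's formula *)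

Section selberg.
Variable R : realType.
Implicit Types n m N d k : nat.
Local Notation Lambda := (@Lambda R).
Local Notation psi := (@chebyshev_psi R).
Local Notation gamma := (@euler_gamma R).

(** Grouping the pairs (d, m) by n = d m, the coefficient of f n is the one found in
    [sum_mobius_ln]. *)
Lemma tatuzawa_iseki (f : nat -> R) (L : R) N : (0 < N)%N ->
  \sum_(1 <= d < N.+1) (mobius d)%:~R * (L - ln d%:R) *
     \sum_(1 <= m < (N %/ d).+1) f (d * m)%N =
  f 1%N * L + \sum_(1 <= n < N.+1) Lambda n * f n.
Proof.
move=> N0; under eq_bigr do rewrite mulr_sumr.
rewrite (dirichlet_hyperbola (fun d n => (mobius d)%:~R * (L - ln d%:R) * f n)).
under eq_big_nat => n /andP[n0 nN].
  rewrite -mulr_suml sum_mobius_ln ?n0 //; over.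
under eq_bigr do rewrite mulrDl.
rewrite big_split /= big_ltn // eqxx mul1r big_nat big1 ?addr0 1?mulrC //.
move=> n /andP[n1 _]; rewrite [_ == _](_ : _ = false) ?mul0r //; lia.
Qed.

(** Errors of size sqrt (N / d) thus add up to O(N) over d <= N. The induction step is 1 / sqrt (N +
    1) <= 2 (sqrt (N + 1) - sqrt N). *)
Lemma sum_invsqrt N : \sum_(1 <= d < N.+1) (Num.sqrt (d%:R : R))^-1 <=
  2 * Num.sqrt N%:R.
Proof.
elim: N => [|N IH]; first by rewrite big_geq // sqrtr0 mulr0.
rewrite big_nat_recr //=; apply: (le_trans (lerD IH (lexx _))).
set a := Num.sqrt N%:R; set b := Num.sqrt N.+1%:R.
have b0 : 0 < b by rewrite sqrtr_gt0 ltr0n.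
have a2 : a ^+ 2 = N%:R by rewrite sqr_sqrtr.
have b2 : b ^+ 2 = a ^+ 2 + 1 by rewrite a2 sqr_sqrtr // natr1.
rewrite -(ler_pM2r b0) mulrDl mulVf ?gt_eqF //.
have : 0 <= (a - b) ^+ 2 by exact: sqr_ge0.
nra.
Qed.

Lemma ln_le_root4 (z : R) : 1 <= z -> ln z <= 4 * Num.sqrt (Num.sqrt z).
Proof.
move=> z1; set s := Num.sqrt (Num.sqrt z).
have z0 : 0 < z by apply: lt_le_trans z1.
have s0 : 0 < s by rewrite !sqrtr_gt0.
have -> : z = s ^+ 4.
  by rewrite (exprM s 2 2) !sqr_sqrtr ?sqrtr_ge0 // ltW.
rewrite lnXn // -[_ *+ 4]mulr_natl ler_pM2l //.
exact/ltW/ln_sublinear.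
Qed.

(** With z = N / d the left side bounds the d-th term in the inversion formula, so that
    [sum_invsqrt] applies. *)
Lemma ln_poly_le_sqrt (z : R) : 1 <= z -> ln z * (2 * ln z + 5) <= 52 * Num.sqrt z.
Proof.
move=> z1; have := ln_le_root4 z1; have := ln_ge0 z1.
set s := Num.sqrt (Num.sqrt z); set l := ln z => l0 ls.
have sq1 : 1 <= Num.sqrt z by rewrite -sqrtr1 ler_wsqrtr.
have s1 : 1 <= s by rewrite -sqrtr1 ler_wsqrtr.
have <- : s ^+ 2 = Num.sqrt z by rewrite sqr_sqrtr // sqrtr_ge0.
apply: (@le_trans _ _ (4 * s * (13 * s))); last by rewrite expr2; lra.
apply: ler_pM => //; lra.
Qed.

(** With y = floor (N / d), the psi terms sum to y ln y - y and the terms N / (d m) to (N / d) (ln y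
    + gamma), up to logarithmic errors; the constant gamma + 1 cancels what is left of order y. *)
Lemma selberg_inner N d : (0 < d <= N)%N ->
  `|\sum_(1 <= m < (N %/ d).+1)
     (psi (N %/ (d * m)) - N%:R / (d * m)%:R + (gamma + 1))|
  <= 2 * ln (N%:R / d%:R) + 5.
Proof.
move=> /andP[d0 dN]; set y := (N %/ d)%N.
have y0 : (0 < y)%N by rewrite divn_gt0.
have y0' : 0 < y%:R :> R by rewrite ltr0n.
have d0' : 0 < d%:R :> R by rewrite ltr0n.
rewrite big_split sumrB /= sumr_const_nat subSS subn0.
under eq_bigr do rewrite divnMA.
rewrite -/y sum_psi_divn.
have -> : \sum_(1 <= m < y.+1) N%:R / (d * m)%:R = N%:R / d%:R * harmonic_sum R y.
  rewrite /harmonic_sum mulr_sumr; apply: eq_bigr => m _.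
  by rewrite natrM invfM mulrA.
have /andP[f1 f2] := @ln_fact_bounds R _ y0.
have /andP[h1 h2] := @harmonic_bounds R _ y0.
have /andP[g1 g2] := @euler_gamma_bounds R.
set z : R := N%:R / d%:R.
have zy : y%:R <= z by rewrite ler_pdivlMr // -natrM ler_nat leq_divM.
have zy1 : z < y%:R + 1 by rewrite ltr_pdivrMr // natr1 -natrM ltr_nat ltn_ceil.
have lyz : ln y%:R <= ln z :> R by rewrite ler_ln // posrE // (lt_le_trans y0').
have ly0 : 0 <= ln y%:R :> R by apply: ln_nat_ge0.
have y1 : 1 <= y%:R :> R by rewrite ler1n.
rewrite -[(gamma + 1) *+ y]mulr_natl.
move: f1 f2 h1 h2; set F := ln_fact R y; set H := harmonic_sum R y.
move: (gamma) g1 g2 => g g1 g2.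
set ly := ln y%:R in lyz ly0 * => f1 f2 h1 h2.
have yi : y%:R * y%:R^-1 = 1 :> R by rewrite mulfV // gt_eqF.
have yi1 : y%:R^-1 <= 1 :> R by rewrite invf_le1.
move: yi yi1 h2; set i := y%:R^-1 => yi yi1 h2.
(* [e] is the error of the harmonic sum, at most 1 / y, and [th] below is the fractional part of N /
   d. *)
set e := H - ly - g; have He : H = ly + g + e by rewrite /e; ring.
have e0 : 0 <= e by rewrite /e; lra.
have ei : e <= i by rewrite /e; lra.
have ye : y%:R * e <= 1 by rewrite -[leRHS]yi ler_pM2l.
have ye0 : 0 <= y%:R * e by rewrite mulr_ge0 // ltW.
set th := z - y%:R; have zE : z = y%:R + th by rewrite /th; ring.
have th0 : 0 <= th by rewrite /th; lra.
have th1 : th <= 1 by rewrite /th; lra.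
have p1 : 0 <= th * H by rewrite mulr_ge0 // He; lra.
have p2 : th * H <= H by rewrite ler_piMl // He; lra.
rewrite [in X in `|X|]zE mulrDl He.
rewrite ler_norml; apply/andP; split; rewrite {}He in p1 p2 *; lra.
Qed.

(* The function f n = psi (N / n) - N / n + gamma + 1 is chosen so that its sums
   over the multiples of d are O(1 + ln (N / d)). *)
Lemma selberg_nat N : (0 < N)%N ->
  `|psi N * ln N%:R + \sum_(1 <= n < N.+1) Lambda n * psi (N %/ n)
     - 2 * N%:R * ln N%:R| <= 140 * N%:R.
Proof.
move=> N0; have N0' : 0 < N%:R :> R by rewrite ltr0n.
pose f n : R := psi (N %/ n) - N%:R / n%:R + (gamma + 1).
have := @tatuzawa_iseki f (ln N%:R) N N0.
set S := \sum_(1 <= d < N.+1) _ => SE.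
have Sle : `|S| <= 104 * N%:R.
  apply: (@le_trans _ _ (\sum_(1 <= d < N.+1)
      52 * Num.sqrt N%:R * (Num.sqrt d%:R)^-1)); last first.
    rewrite -mulr_sumr; apply: (@le_trans _ _ (52 * Num.sqrt N%:R * (2 * Num.sqrt N%:R))).
      by rewrite ler_wpM2l ?sum_invsqrt // mulr_ge0 ?sqrtr_ge0.
    rewrite (_ : _ * (2 * _) = 104 * (Num.sqrt N%:R) ^+ 2); last by ring.
    by rewrite sqr_sqrtr // ltW.
  rewrite /S big_nat [leRHS]big_nat; apply: (le_trans (ler_norm_sum _ _ _)).
  apply: ler_sum => d /andP[d0 dN].
  have d0' : 0 < d%:R :> R by rewrite ltr0n.
  rewrite -ln_div ?posrE // !normrM.
  have z1 : 1 <= N%:R / d%:R :> R by rewrite ler_pdivlMr // mul1r ler_nat.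
  rewrite -[_ * _ / _]mulrA -sqrtrV ?ler0n // -sqrtrM ?ler0n // -mulrA.
  apply: le_trans (ln_poly_le_sqrt z1).
  rewrite (ger0_norm (ln_ge0 z1)) -[leRHS]mul1r ler_pM //.
  - by rewrite mulr_ge0 // ln_ge0.
  - by rewrite -intr_norm -[1]/(1%:~R) ler_int normr_mobius_le1.
  - by rewrite ler_wpM2l ?ln_ge0 // selberg_inner // d0.
have := mertens_bounds R N0; have := psi_le R N; have := psi_ge0 R N.
have lnN : ln N%:R <= N%:R :> R by exact/ltW/ln_sublinear.
have lnN0 : 0 <= ln N%:R :> R by apply: ln_nat_ge0.
have /andP[g1 g2] := @euler_gamma_bounds R.
have sumE : \sum_(1 <= n < N.+1) Lambda n * f n =
   \sum_(1 <= n < N.+1) Lambda n * psi (N %/ n) - N%:R * mertens_sum R N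
   + (gamma + 1) * psi N.
  rewrite /mertens_sum /chebyshev_psi !mulr_sumr -sumrB -big_split /=.
  by apply: eq_bigr => n _; rewrite /f /chebyshev_psi; ring.
move: SE Sle; rewrite sumE {1}/f divn1 divr1 => SE.
rewrite SE.
set P := psi N; set M := mertens_sum R N; set Q := \sum_(1 <= n < N.+1) _.
set l := ln N%:R in lnN lnN0 *; set x := N%:R in N0' lnN *.
move=> /[!ler_norml] /andP[s1 s2] P0 P10 /andP[m1 m2].
(* By Mertens, N M = N ln N + O(N), so - N ln N from f(1) ln N and - N M together make up the - 2 N
   ln N; what remains is O(N). *)
have a1 : 0 <= (gamma + 1) * l <= 2 * x by nra.
have a2 : 0 <= (gamma + 1) * P <= 20 * x by nra.
have a3 : - x <= x * (M - l) <= 11 * x by nra.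
apply/andP; split; nra.
Qed.

End selberg.

(** * Chebyshev's and Mertens' functions of a real variable *)

Section real_variable.
Variable R : realType.
Implicit Types n m N d k : nat.
Implicit Types x y z w : R.
Local Notation Lambda := (@Lambda R).

Definition Psi (x : R) : R := chebyshev_psi R (Num.truncn x).
Definition Mert (x : R) : R := mertens_sum R (Num.truncn x).

Lemma truncn_div x n : 0 <= x -> Num.truncn (x / n%:R) = (Num.truncn x %/ n)%N.
Proof.
move=> x0; have [->|n0] := posnP n; first by rewrite invr0 mulr0 truncn0 divn0.
have n0' : 0 < n%:R :> R by rewrite ltr0n.
have /andP[a b] := truncn_itv x0.
apply: truncn_def; apply/andP; split.
  rewrite ler_pdivlMr // -natrM (le_trans _ a) // ler_nat leq_divM //.
rewrite ltr_pdivrMr // -natrM (lt_le_trans b) // ler_nat ltn_ceil //.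
Qed.

Lemma sum_truncn_interval (f : nat -> R) x y : x <= y ->
  \sum_(1 <= n < (Num.truncn y).+1) f n - \sum_(1 <= n < (Num.truncn x).+1) f n =
  \sum_((Num.truncn x).+1 <= n < (Num.truncn y).+1) f n.
Proof.
move=> /le_truncn xy; rewrite (@big_cat_nat _ _ _ (Num.truncn x).+1) //=.
by rewrite addrAC subrr add0r.
Qed.

Lemma mem_truncn_interval x y n : 0 <= x -> 0 <= y ->
  (Num.truncn x < n < (Num.truncn y).+1)%N = (x < n%:R <= y).
Proof. by move=> x0 y0; rewrite ltnS truncn_lt_nat // truncn_ge_nat. Qed.

Lemma le_Psi : {homo Psi : x y / x <= y}.
Proof. by move=> x y xy; apply/le_psi/le_truncn. Qed.

Lemma Psi_ge0 x : 0 <= Psi x. Proof. exact: psi_ge0. Qed.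

Lemma Psi_le x : 0 <= x -> Psi x <= 10 * x.
Proof.
by move=> x0; apply: (le_trans (psi_le _ _)); rewrite ler_pM2l // truncn_le.
Qed.

Lemma le_Mert : {homo Mert : x y / x <= y}.
Proof.
move=> x y xy; rewrite -subr_ge0 sum_truncn_interval //.
by apply: sumr_ge0 => n _; rewrite divr_ge0 // Lambda_ge0.
Qed.

Lemma ln_truncn x : 1 <= x ->
  ln x - x^-1 * 2 <= ln (Num.truncn x)%:R <= ln x.
Proof.
move=> x1; have x0 : 0 < x by apply: lt_le_trans x1.
have /andP[a b] := truncn_itv (ltW x0).
have n0 : (0 < Num.truncn x)%N by rewrite truncn_gt0.
have n0' : 0 < (Num.truncn x)%:R :> R by rewrite ltr0n.
rewrite [X in _ && X]ler_ln ?posrE // a andbT.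
have /andP[_ c] := @ln_succ_bounds R _ n0.
have d : ln x <= ln (Num.truncn x).+1%:R by rewrite ler_ln ?posrE // ltW.
have : (Num.truncn x)%:R^-1 <= x^-1 * 2.
  rewrite [leRHS]mulrC -[leLHS]mul1r ler_pdivlMr // mulrAC ler_pdivrMr // mul1r.
  have : 1 <= (Num.truncn x)%:R :> R by rewrite ler1n.
  by move: b; rewrite -natr1; lra.
move: c; move: (_^-1) (_^-1) => u v; lra.
Qed.

Lemma Mert_bounds x : 1 <= x -> ln x - 3 <= Mert x <= ln x + 11.
Proof.
move=> x1; have n0 : (0 < Num.truncn x)%N by rewrite truncn_gt0.
have := mertens_bounds R n0; have := ln_truncn x1; rewrite -/(Mert x).
have : x^-1 <= 1 by rewrite invf_le1 // (lt_le_trans _ x1).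
move: (_^-1) => u; lra.
Qed.

Lemma Mert_Psi_ge x y : 0 < x -> x <= y -> (Psi y - Psi x) / y <= Mert y - Mert x.
Proof.
move=> x0 xy; have y0 : 0 < y by apply: lt_le_trans xy.
rewrite /Psi /Mert !sum_truncn_interval // mulr_suml big_nat [leRHS]big_nat.
apply: ler_sum => n; rewrite (mem_truncn_interval _ (ltW x0) (ltW y0)) => /andP[xn ny].
by rewrite ler_wpM2l ?Lambda_ge0 // lef_pV2 ?posrE // (lt_trans x0).
Qed.

Lemma Mert_Psi_le x y : 0 < x -> x <= y -> Mert y - Mert x <= (Psi y - Psi x) / x.
Proof.
move=> x0 xy; have y0 : 0 < y by apply: lt_le_trans xy.
rewrite /Psi /Mert !sum_truncn_interval // mulr_suml big_nat [leRHS]big_nat.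
apply: ler_sum => n; rewrite (mem_truncn_interval _ (ltW x0) (ltW y0)) => /andP[xn ny].
have n0 := lt_trans x0 xn.
by rewrite ler_wpM2l ?Lambda_ge0 // lef_pV2 ?posrE // (ltW xn).
Qed.

(** Psi (x / n) vanishes for n > x, so the sum may stop at any N past x; this lets the formulas at
    two points be subtracted term by term. *)
Lemma selberg_real x N : 1 <= x -> (Num.truncn x <= N)%N ->
  `|Psi x * ln x + \sum_(1 <= n < N.+1) Lambda n * Psi (x / n%:R)
     - 2 * x * ln x| <= 170 * x.
Proof.
move=> x1 xN; have x0 : 0 < x by apply: lt_le_trans x1.
set X := Num.truncn x.
have X0 : (0 < X)%N by rewrite truncn_gt0.
have X0' : 1 <= X%:R :> R by rewrite ler1n.
have /andP[Xx xX] := truncn_itv (ltW x0).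
have -> : \sum_(1 <= n < N.+1) Lambda n * Psi (x / n%:R) =
    \sum_(1 <= n < X.+1) Lambda n * chebyshev_psi R (X %/ n).
  rewrite (@big_cat_nat _ _ _ X.+1) //= [X in _ + X]big_nat.
  rewrite [X in _ + X]big1 ?addr0 => [|n /andP[Xn _]].
    by apply: eq_bigr => n _; rewrite /Psi truncn_div // ltW.
  by rewrite /Psi truncn_div ?ltW // divn_small // /chebyshev_psi big_geq ?mulr0.
have := selberg_nat R X0; have /andP[l1 l2] := ln_truncn x1.
have lx : ln x <= x by exact/ltW/ln_sublinear.
have lx0 : 0 <= ln x by exact: ln_ge0.
have P0 := Psi_ge0 x; have P1 := Psi_le (ltW x0).
rewrite -/X in Xx xX l1 l2 *; rewrite -/(Psi x).
have xi : x * x^-1 = 1 by rewrite mulfV // gt_eqF.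
(* [D] is the loss from rounding x down inside the logarithm. As x D <= 2, it stays bounded even
   when multiplied by Psi x. *)
set D := ln x - ln X%:R.
have D0 : 0 <= D by rewrite /D; lra.
have xD : x * D <= 2.
  by rewrite -(ler_pM2l x0) in l1; rewrite /D; lra.
have PD : 0 <= Psi x * D <= 20.
  apply/andP; split; first by rewrite mulr_ge0.
  apply: (@le_trans _ _ (10 * x * D)); last by lra.
  by rewrite ler_wpM2r.
have -> : ln X%:R = ln x - D by rewrite /D; ring.
set t := x - X%:R; have t0 : 0 <= t by rewrite /t; lra.
have t1 : t <= 1 by move: xX; rewrite /t -natr1; lra.
have -> : X%:R = x - t by rewrite /t; ring.
have tl : 0 <= t * ln x <= ln x by rewrite mulr_ge0 //= ler_piMl.
have tD : 0 <= t * D <= x * D by rewrite mulr_ge0 //= ler_wpM2r //; lra.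
move: (\sum_(1 <= n < X.+1) _) => S.
move=> /[!ler_norml] /andP[s1 s2]; apply/andP; split; lra.
Qed.

Lemma selberg_increment x y N : 1 <= x -> x <= y -> (Num.truncn y <= N)%N ->
  `|(Psi y - Psi x) * ln x + Psi y * (ln y - ln x)
    + \sum_(1 <= n < N.+1) Lambda n * (Psi (y / n%:R) - Psi (x / n%:R))
    - 2 * (y * ln y - x * ln x)| <= 340 * y.
Proof.
move=> x1 xy yN; have y1 : 1 <= y by apply: le_trans xy.
have := selberg_real y1 yN.
have := selberg_real x1 (leq_trans (le_truncn xy) yN).
under [in X in _ -> _ -> X]eq_bigr do rewrite mulrBr.
rewrite sumrB /=.
move: (\sum_(1 <= n < _) _) (\sum_(1 <= n < _) _) => S T.
move=> /[!ler_norml] /andP[s1 s2] /andP[t1 t2]; apply/andP; split; lra.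
Qed.

Lemma sum_Lambda_increment_ge0 x y N : 0 <= x -> x <= y ->
  0 <= \sum_(1 <= n < N.+1) Lambda n * (Psi (y / n%:R) - Psi (x / n%:R)).
Proof.
move=> x0 xy; apply: sumr_ge0 => n _; rewrite mulr_ge0 ?Lambda_ge0 //.
by rewrite subr_ge0 le_Psi // ler_wpM2r.
Qed.

Lemma ln_ratio_le x y : 0 < x -> x <= y -> 0 <= ln y - ln x <= y / x - 1.
Proof.
move=> x0 xy; have y0 : 0 < y by apply: lt_le_trans xy.
rewrite subr_ge0 ler_ln ?posrE // xy /= -ln_div ?posrE //.
have yx0 : 0 < y / x by rewrite divr_gt0.
by rewrite -[X in ln X](subrKC 1) le_ln1Dx //; lra.
Qed.

(** In the differenced Selberg formula all terms other than the first are nonnegative on the side of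
    Psi, and y ln y - x ln x is (y - x) ln x + O(x). Dividing by ln x leaves an error O(x / ln
    x). *)
Lemma Psi_increment_le (K e : R) : 1 <= K -> 0 < e ->
  exists2 Z0 : R, 1 <= Z0 & forall x y, Z0 <= x -> x <= y -> y <= K * x ->
    Psi y - Psi x <= 2 * (y - x) + e * x.
Proof.
move=> K1 e0; pose C := (2 * K * K + 340 * K) / e.
have K0 : 0 <= K by lra.
have KK0 : 0 <= K * K by exact: mulr_ge0.
have C0 : 0 <= C by apply: divr_ge0; [lra | exact: ltW].
(* Past this point e x ln x exceeds the sum of 2 y (ln y - ln x) <= 2 K^2 x and Selberg's error 340
   K x. *)
exists (expR (C + 1)) => [|x y Zx xy yK].
  rewrite -[leLHS]expR0 ler_expR; lra.
have x1 : 1 <= x by apply: le_trans Zx; rewrite -[leLHS]expR0 ler_expR; lra.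
have x0 : 0 < x by apply: lt_le_trans x1.
have lx : C + 1 <= ln x by rewrite -[leLHS]expRK ler_ln ?posrE ?expR_gt0.
have := selberg_increment x1 xy (leqnn _).
have := @sum_Lambda_increment_ge0 x y (Num.truncn y) (ltW x0) xy.
move: (\sum_(1 <= n < _) _) => S S0 /[!ler_norml] /andP[_ s2].
have /andP[r0 r1] := ln_ratio_le x0 xy.
have r2 : ln y - ln x <= K by move: yK; rewrite -ler_pdivrMr //; lra.
have P0 : 0 <= Psi y * (ln y - ln x) by rewrite mulr_ge0 ?Psi_ge0.
have yr : y * (ln y - ln x) <= K * x * K by apply: ler_pM => //; lra.
have Ce : C * e = 2 * K * K + 340 * K by rewrite /C divfK // gt_eqF.
have lx0 : 0 < ln x by lra.
rewrite -(ler_pM2r lx0).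
have : (2 * K * K + 340 * K) * x <= e * x * ln x.
  have ex0 : 0 <= e * x by rewrite mulr_ge0 // ltW.
  have : e * x * C <= e * x * ln x by rewrite ler_wpM2l //; lra.
  by rewrite -Ce; lra.
nra.
Qed.

(** The same formula read the other way: when (x, l x] holds few primes, the sum over n must carry
    nearly all of 2 (l - 1) x ln x. *)
Lemma sum_Lambda_increment_lower (l x : R) N : 1 <= l -> 1 <= x ->
  (Num.truncn (l * x) <= N)%N ->
  2 * (l - 1) * x * ln x - (Psi (l * x) - Psi x) * ln x - (350 + 10 * l) * (l * x)
  <= \sum_(1 <= n < N.+1) Lambda n * (Psi (l * (x / n%:R)) - Psi (x / n%:R)).
Proof.
move=> l1 x1 xN; have x0 : 0 < x by apply: lt_le_trans x1.
have xy : x <= l * x by rewrite ler_peMl // ltW.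
have := selberg_increment x1 xy xN.
under [in X in _ -> X]eq_bigr do rewrite mulrA.
move: (\sum_(1 <= n < _) _) => S /[!ler_norml] /andP[s1 _].
have /andP[r0 r1] := ln_ratio_le x0 xy.
have r2 : ln (l * x) - ln x <= l by move: r1; rewrite mulfK ?gt_eqF //; lra.
have Py := @Psi_le (l * x) (le_trans (ltW x0) xy).
have P1 : Psi (l * x) * (ln (l * x) - ln x) <= 10 * (l * x) * l.
  by apply: ler_pM => //; apply: Psi_ge0.
have : 0 <= l * x * (ln (l * x) - ln x) by rewrite !mulr_ge0 //; lra.
nra.
Qed.

End real_variable.

(** * Gaps between primes *)

Section shortfalls.
Variable R : realType.
Implicit Types n m N d k : nat.
Implicit Types x y z w : R.
Local Notation Lambda := (@Lambda R).
Local Notation Psi := (@Psi R).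
Local Notation Mert := (@Mert R).

Definition positive_density (c : R) : Prop :=
  exists2 e : R, 0 < e & exists X0 : R, forall x, X0 <= x ->
    e * x <= Psi (expR c * x) - Psi x.

Lemma positive_density_le (c c' : R) : c <= c' ->
  positive_density c -> positive_density c'.
Proof.
move=> cc [e e0 [X0 HX]]; exists e => //; exists (Num.max X0 0) => x.
rewrite ge_max => /andP[xX x0]; apply: (le_trans (HX _ xX)).
by rewrite lerB // le_Psi // ler_wpM2r // ler_expR.
Qed.

(** The difference of [Mert] and ln varies by at most 3 + 11, so a logarithmic length 15 leaves mass
    at least 1. *)
Lemma positive_density_large : positive_density 15.
Proof.
exists 1 => //; exists 1 => x x1; have x0 : 0 < x by apply: lt_le_trans x1.
have e1 : 1 <= expR (15 : R) by rewrite -[leLHS]expR0 ler_expR; lra.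
have xy : x <= expR 15 * x by rewrite ler_peMl // ltW.
have := Mert_Psi_le x0 xy; rewrite mul1r ler_pdivlMr // => H.
apply: le_trans H; rewrite ler_peMl ?(ltW x0) //.
have /andP[_ a] := Mert_bounds x1.
have /andP[b _] := Mert_bounds (le_trans x1 xy).
by move: b; rewrite lnM ?posrE ?expR_gt0 // expRK; lra.
Qed.

(* Normalised amount by which (w, lw] falls short of twice the expected density;
   Selberg's formula forces the shortfall at x/n to vanish on average when
   (x, lx] contains few primes. *)
Definition shortfall (l e w : R) : R :=
  2 * (l - 1) + e - (Psi (l * w) - Psi w) / w.

Definition shortfall_sum (l e x y : R) : R :=
  \sum_(1 <= n < (Num.truncn y).+1) Lambda n / n%:R * shortfall l e (x / n%:R).

Lemma shortfall_sumB l e x y z : y <= z ->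
  shortfall_sum l e x z - shortfall_sum l e x y =
  \sum_((Num.truncn y).+1 <= n < (Num.truncn z).+1)
     Lambda n / n%:R * shortfall l e (x / n%:R).
Proof. exact: sum_truncn_interval. Qed.

(** The constant part of the shortfall sums to (2 (l - 1) + e) [Mert], the rest is bounded by
    [sum_Lambda_increment_lower]. The terms 2 (l - 1) ln x cancel; the summand e and the sparse
    interval each leave e ln x. *)
Lemma shortfall_sum_total (l e : R) : 1 <= l -> 0 < e ->
  exists C : R, forall x, 1 <= x -> Psi (l * x) - Psi x <= e * x ->
    shortfall_sum l e x (l * x) <= 2 * e * ln x + C.
Proof.
move=> l1 e0; have l0 : 0 < l by lra.
exists ((2 * (l - 1) + e) * (ln l + 11) + (350 + 10 * l) * l) => x x1 gap.
have x0 : 0 < x by apply: lt_le_trans x1.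
have xy : x <= l * x by rewrite ler_peMl // ltW.
have := sum_Lambda_increment_lower l1 x1 (leqnn _).
set N := Num.truncn (l * x); set S := \sum_(1 <= n < _) _ => HS.
have -> : shortfall_sum l e x (l * x) = (2 * (l - 1) + e) * Mert (l * x) - S / x.
  rewrite /shortfall_sum /Mert /mertens_sum -/N mulr_sumr mulr_suml -sumrB.
  rewrite big_nat [RHS]big_nat; apply: eq_bigr => n /andP[n0 _].
  have n0' : n%:R != 0 :> R by rewrite pnatr_eq0; lia.
  by rewrite /shortfall; field; rewrite n0' gt_eqF.
have /andP[_ m2] := Mert_bounds (le_trans x1 xy).
have lx0 : 0 <= ln x by apply: ln_ge0.
have a0 : 0 <= 2 * (l - 1) + e by lra.
have m3 : (2 * (l - 1) + e) * Mert (l * x) <= (2 * (l - 1) + e) * (ln x + ln l + 11).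
  by apply: ler_wpM2l => //; move: m2; rewrite lnM ?posrE //; lra.
have s2 : 2 * (l - 1) * ln x - e * ln x - (350 + 10 * l) * l <= S / x.
  rewrite ler_pdivlMr //; apply: le_trans HS.
  have := ler_wpM2r lx0 gap; lra.
lra.
Qed.

Lemma shortfall_ge (l e w : R) : 1 <= l -> 0 < e -> 0 < w -> - (10 * l) <= shortfall l e w.
Proof.
move=> l1 e0 w0; have lw : 0 <= l * w by rewrite mulr_ge0 ?(ltW w0) //; lra.
have : (Psi (l * w) - Psi w) / w <= 10 * l.
  rewrite ler_pdivrMr //; have := Psi_le lw; have := Psi_ge0 w; lra.
rewrite /shortfall; lra.
Qed.

(** The summand e in [shortfall] pays for the error term of [Psi_increment_le]. *)
Lemma shortfall_ge0 (l e : R) : 1 <= l -> 0 < e -> exists2 Z0 : R, 1 <= Z0 &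
  forall w, Z0 <= w -> 0 <= shortfall l e w.
Proof.
move=> l1 e0; have [Z0 Z1 HZ] := Psi_increment_le l1 e0; exists Z0 => // w Zw.
have w0 : 0 < w by lra.
have := HZ _ (l * w) Zw; rewrite ler_peMl ?(ltW w0) // => /(_ isT (lexx _)).
rewrite (_ : 2 * _ + _ = (2 * (l - 1) + e) * w); last by ring.
by rewrite -ler_pdivrMr // /shortfall; lra.
Qed.

(* Selberg's formula bounds the sum of the shortfalls over all scales, so some
   block (Y, rY] has a small share of it. *)
Lemma shortfall_block (l e r Y0 Z1 : R) : 1 <= l -> 0 < e -> 1 < r -> 1 <= Y0 ->
  (forall X0 : R, exists2 x, X0 <= x & Psi (l * x) - Psi x <= e * x) ->
  exists x Y, [/\ Y0 <= Y, Z1 * (r * Y) <= x, 0 < x &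
    shortfall_sum l e x (r * Y) - shortfall_sum l e x Y <= 7 * e * ln r].
Proof.
move=> l1 e0 r1 Y1 gaps.
have [C HC] := shortfall_sum_total l1 e0.
have [Z0 Z01 HZ] := shortfall_ge0 l1 e0.
pose Z := Num.max Z0 Z1.
have ZZ0 : Z0 <= Z by rewrite le_max lexx.
have ZZ1 : Z1 <= Z by rewrite le_max lexx orbT.
have Zge1 : 1 <= Z by apply: le_trans ZZ0.
have Zgt0 : 0 < Z by lra.
have lr : 0 < ln r by rewrite ln_gt0.
have l0 : 0 < l by lra.
(* [C2] includes the loss over x / Z < n <= l x, where shortfalls may be negative but are at least -
   10 l. [C3] is what ln x loses when the range from Y0 to x / Z is cut into blocks of ratio r. *)
pose C2 := C + 10 * l * (ln l + ln Z + 14).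
pose C3 := ln Z + ln Y0 + ln r.
have [x] := gaps (Num.max (Z * Y0) (expR ((`|C2| + 7 * e * C3) / e + 1))).
rewrite ge_max => /andP[xZY xE] gap.
have ZY0 : Z <= Z * Y0 by rewrite ler_peMr // ltW.
have x1 : 1 <= x by lra.
have x0 : 0 < x by lra.
have lnx : (`|C2| + 7 * e * C3) / e + 1 <= ln x.
  by rewrite -[leLHS]expRK ler_ln ?posrE ?expR_gt0.
have xl : x / Z <= l * x.
  have lZ : 1 <= l * Z by rewrite mulr_ege1.
  by rewrite ler_pdivrMr // mulrAC ler_peMl // ltW.
have xZ1 : 1 <= x / Z by rewrite ler_pdivlMr // mul1r; lra.
have T1 : shortfall_sum l e x (x / Z) <= 2 * e * ln x + C2.
  have T2 : - (10 * l * (ln l + ln Z + 14)) <=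
      shortfall_sum l e x (l * x) - shortfall_sum l e x (x / Z).
    rewrite shortfall_sumB //.
    apply: (@le_trans _ _ (- (10 * l) * (Mert (l * x) - Mert (x / Z)))).
      rewrite mulNr lerN2 ler_pM2l; last by lra.
      have /andP[_ a] := Mert_bounds (le_trans xZ1 xl).
      have /andP[b _] := Mert_bounds xZ1.
      move: a b; rewrite lnM ?posrE // ln_div ?posrE //; lra.
    rewrite sum_truncn_interval // mulr_sumr big_nat [leRHS]big_nat.
    have lx0 : 0 <= l * x by rewrite mulr_ge0 // ltW.
    have xZ0 : 0 <= x / Z by lra.
    apply: ler_sum => n; rewrite (mem_truncn_interval _ xZ0 lx0) => /andP[n1 _].
    rewrite mulrC ler_wpM2l ?divr_ge0 ?Lambda_ge0 // shortfall_ge //.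
    by rewrite divr_gt0 //; lra.
  have := HC _ x1 gap; rewrite /C2; lra.
have mono y z : 1 <= y -> y <= z -> z <= x / Z ->
    shortfall_sum l e x y <= shortfall_sum l e x z.
  move=> y1 yz zx; rewrite -subr_ge0 shortfall_sumB // big_nat.
  have y0 : 0 <= y by lra.
  have z0 : 0 <= z by lra.
  apply: sumr_ge0 => n; rewrite (mem_truncn_interval _ y0 z0) => /andP[n1 n2].
  have n0 : 0 < n%:R :> R by lra.
  rewrite mulr_ge0 ?divr_ge0 ?Lambda_ge0 // HZ // (le_trans ZZ0) //.
  by rewrite ler_pdivlMr // mulrC -ler_pdivlMr // (le_trans n2).
have T0 y : 1 <= y -> y <= x / Z -> 0 <= shortfall_sum l e x y.
  move=> y1 yx; rewrite /shortfall_sum big_nat.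
  apply: sumr_ge0 => n /andP[n0 n2].
  have n0' : 0 < n%:R :> R by rewrite ltr0n.
  have n2' : n%:R <= y by rewrite -truncn_ge_nat //; lra.
  rewrite mulr_ge0 ?divr_ge0 ?Lambda_ge0 // HZ // (le_trans ZZ0) //.
  by rewrite ler_pdivlMr // mulrC -ler_pdivlMr // (le_trans n2').
pose J := Num.truncn ((ln x - ln Z - ln Y0) / ln r).
have ln0 : 0 <= (ln x - ln Z - ln Y0) / ln r.
  rewrite divr_ge0 ?(ltW lr) //.
  have : ln (Z * Y0) <= ln x by rewrite ler_ln // posrE ?mulr_gt0 //; lra.
  by rewrite lnM ?posrE //; lra.
have /andP[J1 J2] := truncn_itv ln0.
rewrite -/J ler_pdivlMr // in J1; rewrite -/J ltr_pdivrMr // -natr1 in J2.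
have r0 : 0 < r by lra.
have pw k : (k <= J)%N -> Y0 * r ^+ k <= x / Z.
  move=> kJ; rewrite -ler_ln ?posrE ?divr_gt0 ?mulr_gt0 ?exprn_gt0 //; last by lra.
  rewrite ln_div ?posrE // lnM ?posrE ?exprn_gt0 //; last by lra.
  rewrite lnXn // -[ln r *+ k]mulr_natl.
  have : k%:R * ln r <= J%:R * ln r by rewrite ler_wpM2r ?(ltW lr) // ler_nat.
  lra.
have pw1 k : Y0 <= Y0 * r ^+ k.
  by rewrite ler_peMr ?exprn_ege1 //; lra.
have [[k kJ Hk]|bad] := pselect (exists2 k, (k < J)%N &
   shortfall_sum l e x (Y0 * r ^+ k.+1) - shortfall_sum l e x (Y0 * r ^+ k)
     <= 7 * e * ln r).
  have rE : r * (Y0 * r ^+ k) = Y0 * r ^+ k.+1 by rewrite mulrCA exprS.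
  exists x, (Y0 * r ^+ k); rewrite rE; split=> //.
    apply: (@le_trans _ _ (Z * (Y0 * r ^+ k.+1))).
      by rewrite ler_wpM2r // (le_trans _ (pw1 _)) //; lra.
    by rewrite mulrC -ler_pdivlMr // pw.
(* Otherwise the J blocks amount to at least 7 e (ln x - C3), against a total of at most 2 e ln x +
   C2; x was chosen too large for that. *)
exfalso.
have grow k : (k <= J)%N -> k%:R * (7 * e * ln r) <= shortfall_sum l e x (Y0 * r ^+ k).
  elim: k => [|k IH] kJ.
    by rewrite mul0r expr0 mulr1 T0 // -[Y0]mulr1 -(expr0 r) pw.
  have /IH {}IH := ltnW kJ.
  have : 7 * e * ln r <
    shortfall_sum l e x (Y0 * r ^+ k.+1) - shortfall_sum l e x (Y0 * r ^+ k).
    by rewrite ltNge; apply/negP => H; apply: bad; exists k.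
  rewrite -natr1 mulrDl mul1r; lra.
have := grow J (leqnn _); have := mono _ _ (le_trans Y1 (pw1 J)) (pw J (leqnn _)) (lexx _).
have h1 : J%:R * (7 * e * ln r) = 7 * e * (J%:R * ln r) by ring.
have h2 : 7 * e * (ln x - C3) <= 7 * e * (J%:R * ln r).
  by rewrite ler_pM2l ?mulr_gt0 // /C3; lra.
have h3 : (`|C2| + 7 * e * C3) + e <= e * ln x.
  have : e * ((`|C2| + 7 * e * C3) / e + 1) <= e * ln x by rewrite ler_pM2l.
  by rewrite mulrDr mulr1 mulrCA mulfV ?gt_eqF // mulr1.
have := ler_norm C2.
have : 0 <= e * ln x by rewrite mulr_ge0 ?ln_ge0 // ltW.
rewrite h1; lra.
Qed.

End shortfalls.

(** * Covering a range of scales by intervals of small shortfall *)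

Section coverings.
Variable R : realType.
Implicit Types n m N d k : nat.
Implicit Types x y z w : R.
Local Notation Lambda := (@Lambda R).
Local Notation Psi := (@Psi R).
Local Notation Mert := (@Mert R).

(** Averaging: the weights Lambda(n) / n over the window add up to at least d / q, so if every
    shortfall there exceeded 2 t q / d, the sum would reach 2 t. *)
Lemma window_small_shortfall (l e x y z t d q v : R) :
  0 < t -> 0 < d -> 0 < v -> 1 <= q -> y <= v -> q * v <= z -> 0 <= y ->
  d * v <= Psi (q * v) - Psi v ->
  (forall n, y < n%:R <= z -> 0 <= shortfall l e (x / n%:R)) ->
  shortfall_sum l e x z - shortfall_sum l e x y <= t ->
  exists2 n, v < n%:R <= q * v & shortfall l e (x / n%:R) <= 2 * t * q / d.
Proof.
move=> t0 d0 v0 q1 yv vz y0 dens sf0 sumle.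
have vqv : v <= q * v by rewrite ler_peMl // ltW.
have q0 : 0 < q by lra.
have qv0 : 0 < q * v by rewrite mulr_gt0.
have yz : y <= z by lra.
have z0 : 0 <= z by lra.
apply: contrapT => none; suff : 2 * t <= t by lra.
apply: le_trans sumle; rewrite shortfall_sumB //.
have vN := le_truncn yv; have Nz := le_truncn vz; have vv := le_truncn vqv.
have pos n : y < n%:R <= z ->
    0 <= Lambda n / n%:R * shortfall l e (x / n%:R).
  by move=> yn; rewrite !mulr_ge0 ?Lambda_ge0 ?invr_ge0 ?sf0.
apply: (@le_trans _ _ (\sum_((Num.truncn v).+1 <= n < (Num.truncn (q * v)).+1)
    Lambda n / n%:R * shortfall l e (x / n%:R))); last first.
  rewrite [leRHS](@big_cat_nat _ _ _ (Num.truncn v).+1) ?ltnS ?(leq_trans vv) //=.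
  rewrite [X in _ <= _ + X](@big_cat_nat _ _ _ (Num.truncn (q * v)).+1) ?ltnS //=.
  rewrite addrCA lerDl addr_ge0 // big_nat; apply: sumr_ge0 => n.
    rewrite (mem_truncn_interval _ y0 (ltW v0)) => /andP[n1 n2].
    by apply: pos; apply/andP; split; lra.
  rewrite (mem_truncn_interval _ (ltW qv0) z0) => /andP[n1 n2].
  by apply: pos; apply/andP; split; lra.
apply: (@le_trans _ _ ((Mert (q * v) - Mert v) * (2 * t * q / d))).
  apply: (@le_trans _ _ (d / q * (2 * t * q / d))).
    by rewrite le_eqVlt; apply/orP; left; apply/eqP; field; rewrite !gt_eqF.
  rewrite ler_wpM2r //; first by rewrite divr_ge0 ?mulr_ge0 ?(ltW q0) ?(ltW d0) ?(ltW t0).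
  apply: le_trans (Mert_Psi_ge v0 vqv).
  rewrite ler_pdivrMr // mulrAC ler_pdivlMr //.
  by have := ler_wpM2l (ltW q0) dens; lra.
rewrite sum_truncn_interval // mulr_suml big_nat [leRHS]big_nat.
apply: ler_sum => n; rewrite (mem_truncn_interval _ (ltW v0) (ltW qv0)) => nv.
rewrite ler_wpM2l ?divr_ge0 ?Lambda_ge0 // leNgt; apply/negP => H.
by apply: none; exists n => //; apply: ltW.
Qed.

(** Neither (w, a] nor (b, l w] can carry much more than twice the expected mass, so (a, b] inherits
    the near extremality of (w, l w]. *)
Lemma shortfall_subinterval (l e : R) : 1 <= l -> 0 < e ->
  exists2 Z0 : R, 1 <= Z0 & forall w t a b, Z0 <= w -> shortfall l e w <= t ->
    w <= a -> a <= b -> b <= l * w ->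
    2 * (b - a) - (t + e * l) * w <= Psi b - Psi a.
Proof.
move=> l1 e0; have [Z0 Z1 HZ] := Psi_increment_le l1 e0; exists Z0 => //.
move=> w t a b Zw sf wa ab blw.
have w0 : 0 < w by lra.
have alw : a <= l * w by lra.
have h1 := HZ _ _ Zw wa alw.
have h2 : Psi (l * w) - Psi b <= 2 * (l * w - b) + e * b.
  by apply: HZ => //; [lra | rewrite ler_wpM2l //; lra].
have h3 : e * b <= e * (l * w) by rewrite ler_pM2l.
have h4 : (2 * (l - 1) + e - t) * w <= Psi (l * w) - Psi w.
  by rewrite -ler_pdivlMr //; move: sf; rewrite /shortfall; lra.
lra.
Qed.

Lemma Mert_chain (a q t : R) (m j : nat) : 0 <= a -> 1 <= q -> 0 <= t ->
  (forall i, (i < m)%N -> (i < j)%N || (j + 3 <= i)%N ->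
    t <= Mert (a * q ^+ i.+1) - Mert (a * q ^+ i)) ->
  (m - 3)%:R * t <= Mert (a * q ^+ m) - Mert a.
Proof.
move=> a0 q1 t0 H.
(* The coefficient counts the cells below k other than j, j + 1 and j + 2; on those three the
   monotonicity of [Mert] is enough. *)
suff: forall k, (k <= m)%N ->
    (minn k j + (k - (j + 3)))%:R * t <= Mert (a * q ^+ k) - Mert a.
  move=> /(_ m (leqnn m)); apply: le_trans.
  by rewrite ler_wpM2r // ler_nat; lia.
elim=> [|k IH] km.
  by rewrite min0n sub0n mul0r expr0 mulr1 subrr.
have {}IH := IH (ltnW km).
have [kj|kj] := boolP ((k < j) || (j + 3 <= k))%N.
  have := H k km kj.
  have -> : (minn k.+1 j + (k.+1 - (j + 3)) = (minn k j + (k - (j + 3))).+1)%N by lia.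
  by rewrite -natr1 mulrDl mul1r; lra.
have -> : (minn k.+1 j + (k.+1 - (j + 3)) = (minn k j + (k - (j + 3))))%N by lia.
apply: (le_trans IH); rewrite lerB // le_Mert // ler_wpM2l // exprS.
by rewrite ler_peMl // exprn_ge0 //; lra.
Qed.

(* The two intervals (w1, l w1] and (w2, l w2] carry twice the expected density
   and leave at most three of the cells (a q^i, a q^(i+1)] uncovered. *)
Lemma Mert_two_intervals (a q t : R) (m : nat) (w1 w2 : R) :
  1 < q -> 1 <= w1 -> w1 <= a -> a <= w2 -> w2 <= q ^+ (m + 3) * w1 ->
  0 <= 2 * (q - 1) - t -> 0 <= t ->
  (forall w b c, w = w1 \/ w = w2 -> w <= b -> b <= c -> c <= q ^+ m.+1 * w ->
     2 * (c - b) - t * w <= Psi c - Psi b) ->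
  (m - 3)%:R * ((2 * (q - 1) - t) / q) <= Mert (a * q ^+ m) - Mert a.
Proof.
move=> q1 w11 w1a aw2 w2w1 th0 t0 cover.
have q0 : 0 < q by lra.
have a0 : 0 < a by lra.
have lq : 0 < ln q by rewrite ln_gt0.
have w10 : 0 < w1 by lra.
have cell w i : w = w1 \/ w = w2 -> w <= a * q ^+ i ->
    a * q ^+ i.+1 <= q ^+ m.+1 * w ->
    (2 * (q - 1) - t) / q <= Mert (a * q ^+ i.+1) - Mert (a * q ^+ i).
  move=> ww wb cw; have b0 : 0 < a * q ^+ i by rewrite mulr_gt0 // exprn_gt0.
  have bc : a * q ^+ i <= a * q ^+ i.+1.
    by rewrite ler_pM2l // exprS ler_peMl ?(ltW q1) // exprn_ge0 // ltW.
  apply: le_trans (Mert_Psi_ge b0 bc).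
  have cE : a * q ^+ i.+1 = q * (a * q ^+ i) by rewrite exprS; ring.
  have := cover _ _ _ ww wb bc cw.
  have : t * w <= t * (a * q ^+ i) by rewrite ler_wpM2l.
  rewrite cE; move: (a * q ^+ i) b0 => b b0 h1 h2.
  rewrite ler_pdivrMr // mulrAC ler_pdivlMr ?mulr_gt0 //.
  have -> : (2 * (q - 1) - t) * (q * b) = (2 * (q * b - b) - t * b) * q by ring.
  by rewrite ler_pM2r //; lra.
(* The first j cells end no later than q^(m+1) w1. Since w2 <= q^(m+3) w1 < a q^(j+3), the cells
   from j + 3 on begin after w2. *)
pose j := Num.truncn (ln (q ^+ m.+1 * w1 / a) / ln q).
have lE : ln (q ^+ m.+1 * w1 / a) = m.+1%:R * ln q + ln w1 - ln a.
  rewrite ln_div ?posrE ?mulr_gt0 ?exprn_gt0 // lnM ?posrE ?exprn_gt0 //.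
  by rewrite lnXn // -[ln q *+ _]mulr_natl.
apply: (@Mert_chain _ _ _ _ j); rewrite ?(ltW a0) ?(ltW q1) ?divr_ge0 ?(ltW q0) //.
move=> i im /orP[ij|ji].
  apply: (cell w1); first by left.
    by apply: (le_trans w1a); rewrite ler_peMr ?(ltW a0) // exprn_ege1 // ltW.
  move: ij; rewrite /j truncn_gt_nat ler_pdivlMr // lE => ij.
  rewrite -ler_ln ?posrE ?mulr_gt0 ?exprn_gt0 // !lnM ?posrE ?exprn_gt0 //.
  by rewrite !lnXn // -![ln q *+ _]mulr_natl; lra.
have w20 : 0 < w2 by lra.
apply: (cell w2); first by right.
  apply: (le_trans w2w1).
  have jj : ln (q ^+ m.+1 * w1 / a) < j.+1%:R * ln q.
    by rewrite -ltr_pdivrMr // /j truncnS_gt.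
  rewrite lE in jj.
  rewrite -ler_ln ?posrE ?mulr_gt0 ?exprn_gt0 // !lnM ?posrE ?exprn_gt0 //.
  rewrite !lnXn // -![ln q *+ _]mulr_natl.
  have : (j + 3)%:R * ln q <= i%:R * ln q by rewrite ler_pM2r // ler_nat.
  move: jj; rewrite -!natr1 !natrD; lra.
rewrite mulrC ler_pM // ?exprn_ge0 ?(ltW q0) ?(ltW a0) //.
by rewrite ler_weXn2l ?(ltW q1) // leqW.
Qed.

End coverings.

(** * Contradiction between a largest gap ratio and Mertens' estimate *)

Section gap_theorem.
Variable R : realType.
Implicit Types n m N d k : nat.
Implicit Types x y z w : R.
Local Notation Lambda := (@Lambda R).
Local Notation Psi := (@Psi R).
Local Notation Mert := (@Mert R).

(* The two intervals are those at w1 = x / n1, n1 >= x / a least with a small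
   shortfall, and at w2 = x / n2 for some such n2 < n1 found just below n1. *)
Lemma Mert_step (q h d x y r e t Z a : R) (m : nat) :
  0 < h -> 1 + h <= q -> 0 < d -> 0 < t -> h^-1 <= y -> 1 <= y -> 1 <= Z ->
  Z * (r * y) <= x -> 0 < x -> 0 < r -> 0 < e ->
  (forall v, y <= v -> d * v <= Psi (q ^+ m.+2 * v) - Psi v) ->
  (forall w, Z <= w -> 0 <= shortfall (q ^+ m.+1) e w) ->
  (forall w s b c, Z <= w -> shortfall (q ^+ m.+1) e w <= s ->
    w <= b -> b <= c -> c <= q ^+ m.+1 * w ->
    2 * (c - b) - (s + e * q ^+ m.+1) * w <= Psi c - Psi b) ->
  shortfall_sum (q ^+ m.+1) e x (r * y) - shortfall_sum (q ^+ m.+1) e x y <= t ->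
  2 * t * q ^+ m.+2 / d + e * q ^+ m.+1 = h / 4 ->
  q ^+ m.+2 * (x / a) <= r * y -> q ^+ m.+2 * y + 1 <= x / a -> 0 < a ->
  (m - 3)%:R * ((2 * (q - 1) - h / 4) / q) <= Mert (a * q ^+ m) - Mert a.
Proof.
move=> h0 qh d0 t0 yh y1 Z1 Zx x0 r0 e0 dens sf0 sub sumle tE ar ay a0.
set l := q ^+ m.+1 in sf0 sub sumle tE *; set l1 := q ^+ m.+2 in dens tE ar ay *.
set s := 2 * t * l1 / d in tE.
have q1 : 1 < q by lra.
have l1q : l1 = q * l by rewrite /l1 exprS.
have l11 : 1 <= l1 by rewrite exprn_ege1 // ltW.
have l10 : 0 < l1 by lra.
have y0 : 0 < y by lra.
have ly : y <= l1 * y by rewrite ler_peMl // ltW.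
have xa0 : 0 < x / a by rewrite divr_gt0.
have wZ n : y < n%:R <= r * y -> Z <= x / n%:R.
  move=> /andP[yn nr]; have n0 : 0 < n%:R :> R by lra.
  by rewrite ler_pdivlMr // (le_trans _ Zx) // ler_wpM2l //; lra.
have sfn n : y < n%:R <= r * y -> 0 <= shortfall l e (x / n%:R).
  by move=> /wZ; apply: sf0.
have window v : y <= v -> l1 * v <= r * y ->
    exists2 n, v < n%:R <= l1 * v & shortfall l e (x / n%:R) <= s.
  move=> yv vr; apply: (window_small_shortfall t0 d0 _ l11 yv vr _ _ sfn) => //.
  - by lra.
  - exact: ltW.
  - exact: dens.
have [n0 /andP[n0a n0b] n0s] := window (x / a) ltac:(lra) ar.
pose P n := `[< x / a <= n%:R /\ shortfall l e (x / n%:R) <= s >].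
have exP : exists n, P n by exists n0; apply/asboolP; split => //; apply: ltW.
have [n1 /asboolP[n1a n1s] n1min] := ex_minnP exP.
have n1b : n1%:R <= l1 * (x / a).
  apply: le_trans n0b; rewrite ler_nat; apply: n1min; apply/asboolP.
  by split => //; apply: ltW.
have n1y : l1 * y + 1 <= n1%:R by lra.
have n10 : 0 < n1%:R :> R by lra.
(* The window above [v2] ends at n1 - 1, so the n2 found in it is below n1, and minimality of n1
   puts it below x / a. *)
pose v2 := (n1%:R - 1) / l1.
have l1v2 : l1 * v2 = n1%:R - 1 by rewrite /v2 mulrCA mulfV ?mulr1 // gt_eqF.
have [n2 /andP[n2a n2b] n2s] : exists2 n, v2 < n%:R <= l1 * v2 &
    shortfall l e (x / n%:R) <= s.
  apply: window; last by rewrite l1v2; lra.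
  by rewrite /v2 ler_pdivlMr // mulrC; lra.
have n2x : n2%:R < x / a.
  rewrite ltNge; apply/negP => xn2.
  have : (n1 <= n2)%N by apply: n1min; apply/asboolP.
  by rewrite -(ler_nat R); lra.
have v2y : y <= v2 by rewrite /v2 ler_pdivlMr // mulrC; lra.
have n20 : 0 < n2%:R :> R by lra.
have w1in : y < n1%:R <= r * y by apply/andP; split; lra.
have w2in : y < n2%:R <= r * y by apply/andP; split; lra.
have Zw1 := wZ _ w1in; have Zw2 := wZ _ w2in.
have q0 : 0 < q by lra.
rewrite -tE; apply: (@Mert_two_intervals _ _ _ _ _ (x / n1%:R) (x / n2%:R)) => //.
- by lra.
- by rewrite ler_pdivrMr // mulrC -ler_pdivrMr.
- by rewrite ler_pdivlMr // mulrC -ler_pdivlMr // ltW.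
- rewrite (_ : (m + 3)%N = m.+3) ?addn3 // exprS -/l1 ler_pdivrMr //.
  rewrite (_ : q * l1 * (x / n1%:R) * n2%:R = x * (q * l1 * n2%:R / n1%:R)); last by ring.
  rewrite ler_peMr ?(ltW x0) // ler_pdivlMr // mul1r -mulrA.
  have n12 : n1%:R - 1 <= l1 * n2%:R by rewrite -l1v2 ler_pM2l // ltW.
  (* Replacing n1 - 1 by n1 is paid for by one more factor q >= 1 + h, because n1 - 1 >= y >= 1 /
     h. *)
  have hn : 1 <= h * n1%:R - h.
    have : h * h^-1 = 1 by rewrite mulfV // gt_eqF.
    have : h * h^-1 <= h * y by rewrite ler_pM2l.
    have : h * (l1 * y + 1) <= h * n1%:R by rewrite ler_pM2l.
    have : h * y <= h * (l1 * y) by rewrite ler_pM2l.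
    lra.
  apply: (@le_trans _ _ (q * (n1%:R - 1))); last by rewrite ler_pM2l.
  have : (1 + h) * (n1%:R - 1) <= q * (n1%:R - 1) by rewrite ler_wpM2r //; lra.
  by lra.
- by rewrite tE; lra.
- by rewrite tE; lra.
move=> w b c [->|->] wb bc cw; exact: sub.
Qed.

(** A cell has logarithmic length h, so it carries at least 3/2 of its expected share: the factor 2
    survives the loss h / 4 and the division by q. *)
Lemma expR_cell_ratio (h : R) : 0 < h -> h <= 1 / 40 ->
  3 / 2 * h <= (2 * (expR h - 1) - h / 4) / expR h.
Proof.
move=> h0 h1; have q0 : 0 < expR h by exact: expR_gt0.
have q1h := expR_ge1Dx h.
have q2 : expR h * (1 - h) <= 1.
  have := expR_ge1Dx (- h).
  by rewrite -(ler_pM2l q0) -expRD subrr expR0.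
move: (expR h) q0 q1h q2 => q q0 q1h q2.
rewrite ler_pdivlMr //.
have qh : q * h <= q * (1 / 40) by rewrite ler_pM2l.
have q39 : q <= 40 / 39 by lra.
have : h * q <= h * (40 / 39) by rewrite ler_pM2l.
by lra.
Qed.

(** Growth at rate 1.35 over the logarithmic length m T h > 100 puts [Mert] ahead of ln by 35, more
    than the 3 + 11 that [Mert_bounds] allows. *)
Lemma Mert_iterate (h a : R) (m T : nat) : 0 < h -> 1 <= a -> (0 < m)%N ->
  100 < T%:R * h ->
  (forall k, (k < T)%N -> 135 / 100 * (m%:R * h) <=
     Mert (a * expR h ^+ (m * k.+1)) - Mert (a * expR h ^+ (m * k))) -> False.
Proof.
move=> h0 a1 m0 Th H.
have iter k : (k <= T)%N -> k%:R * (135 / 100 * (m%:R * h)) <=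
    Mert (a * expR h ^+ (m * k)) - Mert a.
  elim: k => [|k IH] kT; first by rewrite muln0 expr0 mulr1 mul0r subrr.
  have {}IH := IH (ltnW kT); have := H k kT.
  by rewrite -natr1 mulrDl mul1r; lra.
have := iter T (leqnn T).
have /andP[b1 _] := Mert_bounds a1.
have q1 : 1 <= expR h by rewrite -[leLHS]expR0 ler_expR ltW.
have aT : 1 <= a * expR h ^+ (m * T) by rewrite mulr_ege1 // exprn_ege1.
have /andP[_] := Mert_bounds aT.
rewrite lnM ?posrE ?exprn_gt0 ?expR_gt0 ?(lt_le_trans _ a1) //.
rewrite lnXn ?expR_gt0 // -[ln _ *+ _]mulr_natl expRK natrM => b2 it.
have mT : m%:R * T%:R * h = m%:R * (T%:R * h) by rewrite mulrA.
have big : 100 <= m%:R * (T%:R * h).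
  have m1 : 1 <= m%:R :> R by rewrite ler1n.
  have : T%:R * h <= m%:R * (T%:R * h) by rewrite ler_peMl //; lra.
  by lra.
have : T%:R * (135 / 100 * (m%:R * h)) = 135 / 100 * (m%:R * (T%:R * h)) by ring.
move: it b2 big; rewrite mT; move: (m%:R * (T%:R * h)) => X; lra.
Qed.

(** On the grid of step h = c / 40 let M be the least index with positive density at M h; M <= 40
    would give the claim by monotonicity. Failure at (M - 1) h yields sparse intervals of ratio [l],
    while density at M h supplies mass in every far window of ratio [l1], only one factor q
    larger. *)
Theorem positive_density_all (c : R) : 0 < c -> positive_density c.
Proof.
wlog c1 : c / c <= 1.
  move=> H c0; have [c1|c1] := leP c 1; first exact: H.
  by apply: (positive_density_le (ltW c1)); apply: H.
move=> c0; apply: contrapT => notc.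
pose h := c / 40; have h0 : 0 < h by rewrite /h; lra.
have h1 : h <= 1 / 40 by rewrite /h; lra.
pose G k := `[< positive_density (k%:R * h) >].
have exG : exists k, G k.
  exists (Num.truncn (15 / h)).+1; apply/asboolP.
  apply: (positive_density_le _ (positive_density_large R)).
  by rewrite -ler_pdivrMr // ltW // truncnS_gt.
have [M /asboolP[d d0 [X1 HX1]] Mmin] := ex_minnP exG.
have M41 : (41 <= M)%N.
  rewrite ltnNge; apply/negP => M40; apply: notc.
  apply: (@positive_density_le _ (M%:R * h)); last by exists d => //; exists X1.
  have : M%:R * h <= 40%:R * h by rewrite ler_pM2r // ler_nat.
  by rewrite /h; lra.
pose m := M.-2; have ME : M = m.+2 by rewrite /m; lia.
have m39 : (39 <= m)%N by lia.
(* Losing three cells out of m >= 39 costs less than a tenth, and 9/10 of the rate 3/2 is the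
   135/100 of [Mert_iterate]. *)
have m3 : 9 / 10 * m%:R <= (m - 3)%:R :> R.
  rewrite natrB; last by lia.
  have : 39%:R <= m%:R :> R by rewrite ler_nat.
  by lra.
pose q := expR h.
have qn k : q ^+ k = expR (k%:R * h) by rewrite expRM_natl.
have q1h : 1 + h <= q by exact: expR_ge1Dx.
pose l := q ^+ m.+1; pose l1 := q ^+ m.+2.
have q1 : 1 <= q by lra.
have q0 : 0 < q by lra.
have l_ge1 : 1 <= l by rewrite exprn_ege1.
have l1_ge1 : 1 <= l1 by rewrite exprn_ege1.
have l10 : 0 < l1 by lra.
have l0 : 0 < l by lra.
have gaps e : 0 < e -> forall X0 : R, exists2 x, X0 <= x & Psi (l * x) - Psi x <= e * x.
  move=> e0 X0; apply: contrapT => H.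
  suff : (M <= m.+1)%N by rewrite ME ltnn.
  apply: Mmin; apply/asboolP; exists e => //; exists X0 => x Xx.
  rewrite -qn -/l leNgt; apply/negP => H1; apply: H; exists x => //.
  exact: ltW.
pose T := (Num.truncn (100 / h)).+1.
have Th : 100 < T%:R * h by rewrite -ltr_pdivrMr // truncnS_gt.
(* As a runs from a0 to a0 q^(m T), x / a goes from r y / l1 down to 2 l1 y, within the limits
   required by [gain]. *)
pose r := 2 * l1 ^+ 2 * q ^+ (m * T).
have qmT : 1 <= q ^+ (m * T) by rewrite exprn_ege1.
have r1 : 1 < r.
  have : 1 <= l1 ^+ 2 * q ^+ (m * T) by rewrite mulr_ege1 // exprn_ege1.
  by rewrite /r -mulrA; lra.
have lr : 0 < ln r by rewrite ln_gt0.
(* With t proportional to e, the total loss 2 t l1 / d + e l equals e D; hence the choice e = (h /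
   4) / D. *)
pose D := 14 * ln r * l1 / d + l.
have D0 : 0 < D by rewrite addr_gt0 // divr_gt0 // !mulr_gt0.
pose e := h / 4 / D; have e0 : 0 < e by rewrite !divr_gt0.
pose t := 7 * e * ln r; have t0 : 0 < t.
  by apply: mulr_gt0 => //; apply: mulr_gt0.
have tE : 2 * t * l1 / d + e * l = h / 4.
  rewrite (_ : _ + _ = e * D); last by rewrite /t /D; ring.
  by rewrite /e divfK // gt_eqF.
have [Z0 Z01 HZ0] := shortfall_ge0 l_ge1 e0.
have [Z2 Z21 HZ2] := shortfall_subinterval l_ge1 e0.
pose Z := Num.max Z0 Z2.
have ZZ0 : Z0 <= Z by rewrite le_max lexx.
have ZZ2 : Z2 <= Z by rewrite le_max lexx orbT.
pose Y0 := Num.max 1 (Num.max X1 h^-1).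
have Y01 : 1 <= Y0 by rewrite le_max lexx.
have Y0X : X1 <= Y0 by rewrite !le_max lexx orbT.
have Y0h : h^-1 <= Y0 by rewrite !le_max lexx !orbT.
have [x [y [Yy Zx x0 sumle]]] := shortfall_block Z l_ge1 e0 r1 Y01 (gaps e e0).
have y0 : 0 < y by lra.
have r0 : 0 < r by lra.
have step a : 0 < a -> l1 * (x / a) <= r * y -> l1 * y + 1 <= x / a ->
    (m - 3)%:R * ((2 * (q - 1) - h / 4) / q) <= Mert (a * q ^+ m) - Mert a.
  move=> a0 ar ay.
  apply: (@Mert_step q h d x y r e t Z a m h0 q1h d0 t0 (le_trans Y0h Yy)
    (le_trans Y01 Yy) (le_trans Z01 ZZ0) Zx x0 r0 e0 _ _ _ sumle tE ar ay a0).
  - move=> v yv; rewrite qn -ME; apply: HX1.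
    exact: le_trans Y0X (le_trans Yy yv).
  - by move=> w Zw; apply: HZ0; exact: le_trans ZZ0 Zw.
  - by move=> w s b c' Zw; apply: HZ2; exact: le_trans ZZ2 Zw.
have th : 3 / 2 * h <= (2 * (q - 1) - h / 4) / q by exact: expR_cell_ratio.
have gain a : 0 < a -> l1 * (x / a) <= r * y -> l1 * y + 1 <= x / a ->
    135 / 100 * (m%:R * h) <= Mert (a * q ^+ m) - Mert a.
  move=> a0 ar ay; apply: le_trans (step a a0 ar ay).
  apply: (@le_trans _ _ (9 / 10 * m%:R * (3 / 2 * h))).
    by rewrite le_eqVlt; apply/orP; left; apply/eqP; field.
  have e1 : 0 <= 3 / 2 * h by rewrite mulr_ge0 // ltW.
  have e2 : 0 <= 9 / 10 * m%:R :> R by rewrite mulr_ge0.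
  exact: ler_pM.
pose a0 := l1 * x / (r * y).
have ry0 : 0 < r * y := mulr_gt0 r0 y0.
have a00 : 0 < a0 := divr_gt0 (mulr_gt0 l10 x0) ry0.
have a0E : a0 * q ^+ (m * T) = x / (2 * l1 * y).
  rewrite /a0 /r; field.
  by rewrite !gt_eqF // exprn_gt0.
have a01 : 1 <= a0.
  rewrite /a0 ler_pdivlMr // mul1r.
  have p1 : r * y <= Z * (r * y).
    by rewrite ler_peMl ?(le_trans Z01) // ltW.
  by apply: (le_trans p1); apply: (le_trans Zx); rewrite ler_peMl // ltW.
have m0 : (0 < m)%N by exact: leq_trans m39.
apply: (Mert_iterate h0 a01 m0 Th) => k kT; rewrite -/q.
have a0k : a0 <= a0 * q ^+ (m * k) by rewrite ler_peMr ?(ltW a00) // exprn_ege1.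
have akT : a0 * q ^+ (m * k) <= x / (2 * l1 * y).
  by rewrite -a0E ler_pM2l // ler_weXn2l // leq_mul2l (ltnW kT) orbT.
have ak0 : 0 < a0 * q ^+ (m * k) by exact: lt_le_trans a0k.
rewrite mulnSr exprD mulrA; apply: gain => //.
  apply: (@le_trans _ _ (l1 * (x / a0))).
    by rewrite ler_pM2l // ler_pM2l // lef_pV2 // posrE.
  rewrite le_eqVlt; apply/orP; left; apply/eqP; rewrite /a0; field.
  by rewrite !gt_eqF.
have ly1 : 1 <= l1 * y by rewrite mulr_ege1 // (le_trans Y01).
apply: (@le_trans _ _ (2 * l1 * y)); first by rewrite -mulrA mulrDl mul1r lerD2l.
have l1y0 : 0 < 2 * l1 * y by apply: mulr_gt0 => //; apply: mulr_gt0.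
by rewrite ler_pdivlMr // mulrC -ler_pdivlMr.
Qed.

End gap_theorem.

(** * Primes near the powers n^(1/beta) *)

Section prime_windows.
Variable R : realType.
Implicit Types n m N d k p : nat.
Implicit Types x y z w : R.
Local Notation Lambda := (@Lambda R).
Local Notation Psi := (@Psi R).

Lemma sum_seq_le (s : seq nat) (F : nat -> R) (b : R) :
  (forall p, p \in s -> F p <= b) -> \sum_(p <- s) F p <= (size s)%:R * b.
Proof.
elim: s => [|a s IH] H; first by rewrite big_nil mul0r.
rewrite big_cons /= -natr1 mulrDl mul1r addrC lerD ?IH ?H ?mem_head // => p ps.
by rewrite H // in_cons ps orbT.
Qed.

Lemma sum_prime_powers_le p N : prime p -> (0 < N)%N ->
  \sum_(1 <= k < N.+1 | (p ^ k <= N)%N) ln (p%:R : R) <= ln N%:R.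
Proof.
move=> pp N0; have p1 := prime_gt1 pp.
have pT := trunc_logP p1 N0; set T := trunc_log p N in pT.
have TN : (T <= N)%N by rewrite (leq_trans (ltnW (ltn_expl T p1))).
apply: (@le_trans _ _ (\sum_(1 <= k < T.+1) ln (p%:R : R))).
  rewrite (@big_cat_nat _ _ _ T.+1) //= [X in _ + X]big_nat_cond.
  rewrite [X in _ + X]big_pred0 ?addr0 => [|k].
    rewrite big_mkcond; apply: ler_sum => k _; case: ifP => // _.
    exact: ln_nat_ge0.
  apply/negP => /andP[/andP[Tk _] /(trunc_log_max p1)]; rewrite -/T; lia.
rewrite sumr_const_nat subSS subn0 -lnXn ?ltr0n ?prime_gt0 // -natrX.
have pT0 : (0 < p ^ T)%N by rewrite expn_gt0 prime_gt0.
by rewrite ler_ln ?posrE ?ltr0n // ler_nat.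
Qed.

(** A nonprime n with Lambda(n) nonzero is p^k with k >= 2, so p <= sqrt N, and the powers of one p
    up to N contribute at most ln N. *)
Lemma sum_Lambda_nonprime N : (0 < N)%N ->
  \sum_(1 <= n < N.+1 | ~~ prime n) Lambda n <= Num.sqrt N%:R * ln N%:R.
Proof.
move=> N0.
have lnN := ln_nat_ge0 R N.
apply: (@le_trans _ _ (\sum_(1 <= p < N.+1 | prime p)
    \sum_(1 <= k < N.+1) \sum_(1 <= n < N.+1 | ~~ prime n)
       (n == p ^ k)%N%:R * ln (p%:R : R))).
  rewrite big_nat_cond.
  under eq_bigr => n /andP[/andP[_ nN] _] do rewrite (@Lambda_widen R n N) //.
  rewrite -big_nat_cond exchange_big /=.
  by apply: ler_sum => p _; rewrite exchange_big.
apply: (@le_trans _ _ (\sum_(1 <= p < N.+1 | prime p)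
    (if (p * p <= N)%N then ln N%:R else 0))).
  rewrite big_nat_cond [leRHS]big_nat_cond.
  apply: ler_sum => p /andP[/andP[p0 _] pp].
  have inner k : (0 < k)%N -> \sum_(1 <= n < N.+1 | ~~ prime n) (n == p ^ k)%N%:R * ln (p%:R : R)
      <= if [&& 1 < k & p ^ k <= N]%N then ln p%:R else 0.
    move=> k0; have [/andP[k1 kN]|kk] := ifP.
      rewrite big_mkcond (bigD1_seq (p ^ k)%N) ?mem_index_iota ?iota_uniq ?expn_gt0 ?p0 //=.
      rewrite [X in _ + X]big1 ?addr0 => [|n /negbTE ->]; last by rewrite mul0r if_same.
      by rewrite eqxx mul1r; case: ifP => // _; exact: ln_nat_ge0.
    rewrite big_nat_cond big1 // => n /andP[/andP[n0 nN] npr].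
    case: eqP => [nE|_]; rewrite ?mul0r //.
    have nN' : (n <= N)%N by [].
    move: kk; rewrite -nE nN' andbT.
    by case: k k0 nE => [|[|k]] // _ nE _; rewrite nE expn1 pp in npr.
  apply: (@le_trans _ _ (\sum_(1 <= k < N.+1)
      if [&& 1 < k & p ^ k <= N]%N then ln (p%:R : R) else 0)).
    rewrite big_nat [leRHS]big_nat; apply: ler_sum => k /andP[k0 _].
    exact: inner.
  case: ifP => ppN.
    apply: le_trans (sum_prime_powers_le pp N0).
    rewrite [leRHS]big_mkcond; apply: ler_sum => k _.
    have lp := ln_nat_ge0 R p.
    by case: (1 < k)%N => /=; case: ifP.
  rewrite big1 // => k _; case: ifP => // /andP[k1 pkN].
  have : (p ^ 2 <= p ^ k)%N by rewrite leq_pexp2l.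
  by rewrite -mulnn => /leq_trans /(_ pkN); rewrite ppN.
rewrite -big_mkcondr /=.
have -> : \sum_(1 <= i < N.+1 | prime i && (i * i <= N)%N) ln (N%:R : R) =
  \sum_(i <- [seq i <- index_iota 1 N.+1 | prime i && (i * i <= N)%N]) ln (N%:R : R).
  by rewrite big_filter.
apply: (le_trans (sum_seq_le (b := ln N%:R) _)) => //.
rewrite ler_wpM2r //.
set s := [seq i <- _ | _].
have : (size s <= size (index_iota 1 (Num.truncn (Num.sqrt (N%:R : R))).+1))%N.
  apply: uniq_leq_size => [|i]; first by rewrite filter_uniq // iota_uniq.
  rewrite mem_filter !mem_index_iota => /andP[/andP[_ ii] /andP[i0 _]].
  rewrite i0 /= ltnS truncn_ge_nat ?sqrtr_ge0 //.
  by rewrite -(ler_pXn2r (n := 2)) ?nnegrE ?sqrtr_ge0 // sqr_sqrtr // -natrX -mulnn ler_nat.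
rewrite size_iota subSS subn0 -(ler_nat R) => /le_trans; apply.
by rewrite truncn_le sqrtr_ge0.
Qed.

Definition primes_between (x y : R) : seq nat :=
  [seq p <- index_iota (Num.truncn x).+1 (Num.truncn y).+1 | prime p].

Lemma mem_primes_between x y p : 0 <= x -> 0 <= y ->
  (p \in primes_between x y) = prime p && (x < p%:R <= y).
Proof. by move=> x0 y0; rewrite mem_filter mem_index_iota mem_truncn_interval. Qed.

Lemma Psi_increment_primes x y : 1 <= x -> x <= y ->
  Psi y - Psi x <= ((size (primes_between x y))%:R + Num.sqrt y) * ln y.
Proof.
move=> x1 xy; have x0 : 0 <= x by lra.
have y1 : 1 <= y by lra.
have y0 : 0 <= y by lra.
rewrite /Psi sum_truncn_interval // (bigID prime) /= mulrDl lerD //.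
  rewrite -big_filter; apply: sum_seq_le => p; rewrite mem_primes_between //.
  move=> /and3P[pp _ py]; apply: (le_trans (Lambda_le_ln _ _)).
  by rewrite ler_ln ?posrE ?ltr0n ?prime_gt0 //; lra.
have Y0 : (0 < Num.truncn y)%N by rewrite truncn_gt0.
apply: (@le_trans _ _ (\sum_(1 <= n < (Num.truncn y).+1 | ~~ prime n) Lambda n)).
  rewrite [leRHS](@big_cat_nat _ _ _ (Num.truncn x).+1) ?ltnS ?le_truncn //=.
  by rewrite lerDr; apply: sumr_ge0 => n _; apply: Lambda_ge0.
apply: (le_trans (sum_Lambda_nonprime Y0)).
have /andP[a _] := truncn_itv y0.
by apply: ler_pM; rewrite ?sqrtr_ge0 ?ln_nat_ge0 ?ler_wsqrtr ?ler_ln ?posrE ?ltr0n //; lra.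
Qed.

(* The powers of x = e^u are compared through s = e^((1-g)u/2). *)
Lemma exp_dominates (g C c e : R) : g < 1 -> 0 < e -> 0 <= C -> 0 <= c ->
  exists U : R, forall u, U <= u -> 0 <= u ->
    C * expR (g * u) * (c + u) < e * expR u.
Proof.
move=> g1 e0 C0 c0; pose a := (1 - g) / 2; have a0 : 0 < a by rewrite /a; lra.
pose K := C * (c + a^-1) / e.
have K0 : 0 <= K by rewrite divr_ge0 ?mulr_ge0 ?addr_ge0 ?invr_ge0 // ltW.
exists ((K + 1) / a) => u; rewrite ler_pdivrMr // => Ku u0.
set s := expR (u * a).
have sK : K < s by rewrite /s (lt_le_trans _ (expR_ge1Dx _)) //; lra.
have s1 : 1 <= s by rewrite /s -[leLHS]expR0 ler_expR mulr_ge0 // ltW.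
have us : u <= a^-1 * s.
  rewrite -ler_pdivrMl ?invr_gt0 // invrK mulrC.
  by have := expR_ge1Dx (u * a); rewrite -/s; lra.
have eE : expR u = expR (g * u) * (s * s).
  by rewrite /s -!expRD; congr expR; rewrite /a; field.
have -> : C * expR (g * u) * (c + u) = expR (g * u) * (C * (c + u)) by ring.
have -> : e * expR u = expR (g * u) * (e * s * s) by rewrite eE; ring.
rewrite ltr_pM2l ?expR_gt0 //.
apply: (@le_lt_trans _ _ (e * s * K)).
  have -> : e * s * K = C * ((c + a^-1) * s).
    by rewrite /K; field; rewrite !gt_eqF.
  rewrite ler_wpM2l // mulrDl lerD // ler_peMr //.
by rewrite ltr_pM2l // mulr_gt0 //; lra.
Qed.

(** Put x = n^(1 / beta). If at most n = x^beta primes lay in (x, e^c x], the mass there would be at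
    most (x^beta + O(sqrt x)) (c + ln x), which is o(x) as beta < 1. The exponent [g] dominates both
    beta and 1/2. *)
Lemma many_primes (beta c : R) : 0 < beta -> beta < 1 -> 0 < c ->
  exists N0, forall n, (N0 <= n)%N ->
    (n < size (primes_between (expR (ln n%:R / beta))
                              (expR c * expR (ln n%:R / beta))))%N.
Proof.
move=> b0 b1 c0; have [e e0 [X0 HX]] := positive_density_all c0.
pose g := Num.max beta (1 / 2).
have gb : beta <= g by rewrite le_max lexx.
have gh : 1 / 2 <= g by rewrite le_max lexx orbT.
have g1 : g < 1 by rewrite gt_max b1; lra.
have C0 : 0 <= 1 + expR (c / 2) by rewrite addr_ge0 // expR_ge0.
have [U HU] := exp_dominates g1 e0 C0 (ltW c0).
pose V := Num.max 0 (Num.max U X0).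
have V0 : 0 <= V by rewrite le_max lexx.
have VU : U <= V by rewrite !le_max lexx orbT.
have VX : X0 <= V by rewrite !le_max lexx !orbT.
exists (Num.truncn (expR V)).+1 => n nN.
have nV : expR V <= n%:R by rewrite (le_trans (ltW (truncnS_gt _))) // ler_nat.
have n0 : 0 < n%:R :> R by rewrite (lt_le_trans (expR_gt0 V)).
have lnV : V <= ln n%:R by rewrite -[leLHS]expRK ler_ln ?posrE ?expR_gt0.
have ln0 : 0 <= ln n%:R :> R by apply: ln_nat_ge0.
set u := ln n%:R / beta.
have uln : ln n%:R <= u by rewrite /u ler_pdivlMr // ler_piMr // ltW.
have u0 : 0 <= u by lra.
set x := expR u; have x1 : 1 <= x by rewrite -[leLHS]expR0 ler_expR.
have xX : X0 <= x.
  by have := expR_ge1Dx u; rewrite -/x; lra.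
have xy : x <= expR c * x.
  by rewrite ler_peMl ?expR_ge0 // -[leLHS]expR0 ler_expR ltW.
have := le_trans (HX x xX) (Psi_increment_primes x1 xy).
rewrite lnM ?posrE ?expR_gt0 // !expRK -/u => H.
rewrite -(ltr_nat R) ltNge; apply/negP => small.
have := HU u ltac:(lra) u0; rewrite ltNge => /negP; apply.
apply: (le_trans H); rewrite ler_wpM2r //; first by lra.
rewrite mulrDl mul1r lerD //.
  apply: (le_trans small); rewrite -[leLHS]lnK ?posrE // ler_expR.
  have -> : ln n%:R = beta * u by rewrite /u mulrC divfK // gt_eqF.
  by rewrite ler_wpM2r.
have -> : Num.sqrt (expR c * x) = expR (c / 2) * expR (u / 2).
  have -> : expR c * x = (expR (c / 2) * expR (u / 2)) ^+ 2.
    by rewrite exprMn -!expRM_natl /x; congr (expR _ * expR _); field.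
  by rewrite sqrtr_sqr ger0_norm // mulr_ge0 ?expR_ge0.
rewrite ler_pM2l ?expR_gt0 // ler_expR.
have : 1 / 2 * u <= g * u by rewrite ler_wpM2r.
by lra.
Qed.

(** Take the largest k <= n with N0 k <= n: its window holds more than n primes, hence one outside
    s, and this serves every smaller k as well. If there is no such k, any prime outside s does. *)
Lemma nthroot_prime_candidate (beta : R) (N0 : nat -> nat) :
  0 < beta ->
  (forall k n, (N0 k <= n)%N ->
    (n < size (primes_between (expR (ln n%:R / beta))
                              (expR (k.+1%:R^-1) * expR (ln n%:R / beta))))%N) ->
  forall n (s : seq nat), (size s <= n)%N -> exists q, [/\ prime q, q \notin s &
    forall k, (k <= n)%N -> (N0 k <= n)%N ->
      `|beta * ln q%:R - ln n%:R| <= beta / k.+1%:R].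
Proof.
move=> b0 HN n s sn.
have [/existsP[k0 k0P]|noK] := boolP [exists k : 'I_n.+1, (N0 k <= n)%N].
  have exP : exists k, (k <= n)%N && (N0 k <= n)%N.
    by exists (val k0); rewrite k0P andbT -ltnS ltn_ord.
  have ubP k : (k <= n)%N && (N0 k <= n)%N -> (k <= n)%N by case/andP.
  have [k /andP[kn Nk] kmax] := ex_maxnP exP ubP.
  set x := expR (ln n%:R / beta); set y := expR k.+1%:R^-1 * x.
  have x0 : 0 < x by exact: expR_gt0.
  have y0 : 0 < y by rewrite mulr_gt0 ?expR_gt0.
  have [/allP sub|] := boolP (all (fun q => q \in s) (primes_between x y)).
    have szs := uniq_leq_size (filter_uniq _ (iota_uniq _ _)) sub.
    have := leq_trans (HN k n Nk) (leq_trans szs sn).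
    by rewrite ltnn.
  rewrite -has_predC => /hasP[q qw qs]; exists q.
  move: qw; rewrite (mem_primes_between _ (ltW x0) (ltW y0)) => /and3P[pq xq qy].
  split=> // j jn Nj.
  have q0 : 0 < q%:R :> R by rewrite ltr0n prime_gt0.
  have jk : (j <= k)%N by apply: kmax; rewrite jn Nj.
  have l1 : ln n%:R / beta <= ln q%:R.
    by rewrite -[leLHS]expRK ler_ln ?posrE // ltW.
  have l2 : ln q%:R <= k.+1%:R^-1 + ln n%:R / beta.
    by rewrite -[leRHS]expRK ler_ln ?posrE ?expR_gt0 // expRD.
  have l3 : k.+1%:R^-1 <= j.+1%:R^-1 :> R.
    by rewrite lef_pV2 ?posrE ?ltr0n // ler_nat.
  rewrite ler_pdivrMr // in l1.
  have l4 : beta * ln q%:R <= beta / j.+1%:R + ln n%:R.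
    have : beta * ln q%:R <= beta * (j.+1%:R^-1 + ln n%:R / beta).
      by rewrite ler_pM2l //; apply: (le_trans l2); rewrite lerD2r.
    by rewrite mulrDr [beta * (_ / beta)]mulrC divfK ?gt_eqF.
  have : 0 <= beta / j.+1%:R by rewrite divr_ge0 // ltW.
  move: l1 l4; move: (beta / _) => v; rewrite [ln q%:R * _]mulrC => l1 l4 v0.
  by rewrite ler_norml; apply/andP; split; lra.
have [q qs pq] := prime_above (\max_(i <- s) i).
exists q; split=> // [|k kn Nk].
  apply/negP => qins; move: qs; rewrite ltnNge; apply/negP/negPn.
  by rewrite (big_rem q) //= leq_maxl.
move: noK; rewrite negb_exists => /forallP /(_ (inord k)).
by rewrite inordK ?ltnS // Nk.
Qed.

Lemma prime_injection (beta : R) : 0 < beta -> beta < 1 ->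
  exists q : nat -> nat, [/\ injective q, forall n, prime (q n) &
    forall e : R, 0 < e -> exists N, forall n, (N <= n)%N ->
      `|beta * ln (q n)%:R - ln n%:R| <= e].
Proof.
move=> b0 b1.
have /choice[N0 HN0] k := many_primes b0 b1 (c := k.+1%:R^-1) ltac:(by rewrite invr_gt0).
have cand := nthroot_prime_candidate b0 HN0.
have /choice[g Hg] (ns : nat * seq nat) : exists q, (size ns.2 <= ns.1)%N ->
    [/\ prime q, q \notin ns.2 & forall k, (k <= ns.1)%N -> (N0 k <= ns.1)%N ->
      `|beta * ln q%:R - ln ns.1%:R| <= beta / k.+1%:R].
  have [le|gt] := leqP (size ns.2) ns.1; last by exists 0%N.
  by have [q Hq] := cand _ _ le; exists q.
(* [L n] lists the primes chosen for the numbers below n; its length is n, just what the choice of a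
   new prime tolerates. *)
pose L := fix L n := if n is m.+1 then g (m, L m) :: L m else [::].
have sL n : size (L n) = n by elim: n => //= n ->.
pose q n := g (n, L n).
have Hq n := Hg (n, L n) ltac:(by rewrite /= sL).
have memL m n : (m < n)%N -> q m \in L n.
  elim: n => // n IH; rewrite ltnS leq_eqVlt => /orP[/eqP->|mn] /=.
    by rewrite mem_head.
  by rewrite in_cons IH // orbT.
exists q; split=> [m n|n|e e0].
- have [mn|mn|//] := ltngtP m n => E.
    by have [_ /negP] := Hq n; case; rewrite -[g _]/(q n) -E; exact: memL.
  by have [_ /negP] := Hq m; case; rewrite -[g _]/(q m) E; exact: memL.
- by have [] := Hq n.
pose k := Num.truncn (beta / e).
exists (maxn k (N0 k)) => n; rewrite geq_max => /andP[kn Nk].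
have [_ _ /(_ k kn Nk) Hk] := Hq n; apply: (le_trans Hk).
by rewrite ler_pdivrMr // mulrC -ler_pdivrMr // ltW // truncnS_gt.
Qed.

End prime_windows.

(** * Sums over blocks *)

Section esum_lemmas.
Variable R : realType.
Local Open Scope ereal_scope.

Lemma subset_esum (T : choiceType) (I J : set T) (a : T -> \bar R) :
  I `<=` J -> \esum_(i in I) a i <= \esum_(i in J) a i.
Proof.
move=> IJ; apply: le_ereal_sup => _ [X [fX XI] <-]; exists X => //.
by split=> //; apply: subset_trans IJ.
Qed.

Lemma esumU_le (T : choiceType) (I J : set T) (a : T -> \bar R) :
  (forall i, 0 <= a i) ->
  \esum_(i in I `|` J) a i <= \esum_(i in I) a i + \esum_(i in J) a i.
Proof.
move=> a0; rewrite (esumID I) //; apply: leeD; apply: subset_esum.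
  exact: subIsetr.
by move=> x [[//|//] nIx]; have := nIx.
Qed.

Lemma esumZl (T : choiceType) (I : set T) (c : R) (a : T -> \bar R) :
  (0 <= c)%R -> (forall i, 0 <= a i) ->
  \esum_(i in I) (c%:E * a i) = c%:E * \esum_(i in I) a i.
Proof.
(* The opposite inequality is this one for the factor c^-1 and the family c a. *)
have le (d : R) (b : T -> \bar R) : (0 <= d)%R -> (forall i, 0 <= b i) ->
    \esum_(i in I) (d%:E * b i) <= d%:E * \esum_(i in I) b i.
  move=> d0 b0; apply: ge_ereal_sup => _ [X [fX XI] <-].
  rewrite -ge0_mule_fsumr //; apply: lee_wpmul2l; first by rewrite lee_fin.
  by apply: esum_ge; exists X.
move=> c0 a0; apply/eqP; rewrite eq_le le //=.
have [->|cn0] := eqVneq c 0%R.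
  by rewrite mul0e esum_ge0 // => i _; rewrite mul0e.
have {cn0}c0 : (0 < c)%R by rewrite lt_neqAle eq_sym cn0.
rewrite -lee_pdivlMl //; apply: le_trans (le c^-1%R (fun i => c%:E * a i) _ _).
- by apply: le_esum => i _; rewrite muleA -EFinM mulVf ?gt_eqF // mul1e.
- by rewrite invr_ge0 ltW.
- by move=> i; rewrite mule_ge0 // lee_fin ltW.
Qed.

Lemma esum_linear (T : choiceType) (I : set T) (c d : R) (a b : T -> \bar R) :
  (0 <= c)%R -> (0 <= d)%R -> (forall i, 0 <= a i) -> (forall i, 0 <= b i) ->
  \esum_(i in I) (c%:E * a i + d%:E * b i) =
  c%:E * (\esum_(i in I) a i) + d%:E * \esum_(i in I) b i.
Proof.
move=> c0 d0 a0 b0; rewrite esumD => [|i _|i _]; last 2 first.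
- by rewrite mule_ge0 // lee_fin.
- by rewrite mule_ge0 // lee_fin.
by rewrite !esumZl.
Qed.

Lemma nat_esum_le (A : set nat) (a : nat -> \bar R) (C : \bar R) :
  (forall i, 0 <= a i) ->
  (forall n, \sum_(0 <= i < n | i \in A) a i <= C) -> \esum_(i in A) a i <= C.
Proof.
move=> a0 H; have -> : A = [set x | x \in A].
  by apply/seteqP; split=> x /=; rewrite inE.
rewrite -nneseries_esum //; apply: lime_le.
  by apply: is_cvg_nneseries => n _ _; apply: a0.
by apply: nearW => n; apply: H.
Qed.

Lemma esum_halves : \esum_(i in [set: nat]) ((2^-1)%R ^+ i)%:E < +oo :> \bar R.
Proof.
apply: (@le_lt_trans _ _ 2%:E); last by rewrite ltry.
apply: nat_esum_le => [i|n]; first by rewrite lee_fin exprn_ge0.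
suff -> : \sum_(0 <= i < n | i \in [set: nat]) ((2^-1)%R ^+ i)%:E =
    (2 - 2 * 2^-1 ^+ n)%R%:E :> \bar R.
  by rewrite lee_fin lerBlDr lerDl mulr_ge0 // exprn_ge0.
elim: n => [|n IH]; first by rewrite big_geq // expr0 mulr1 subrr.
rewrite big_mkcond big_nat_recr //= -big_mkcond /= IH in_setT -EFinD exprS.
by congr EFin; lra.
Qed.

End esum_lemmas.

(** * Comparing the sum over p with the sums over p r and p r u *)

Section pairs_and_triples.
Variable R : realType.
Variables (A : set nat) (F : nat -> set nat) (s : nat -> R).
Hypothesis FA : forall p, A p -> F p `<=` A.
Hypothesis trivF : trivIset setT F.
Hypothesis mass_ge1 : forall p, A p -> (1 <= \esum_(r in F p) (r%:R^-1 : R)%:E)%E.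
Hypothesis mass_le2 : forall p, A p -> (\esum_(r in F p) (r%:R^-1 : R)%:E <= 2%:E)%E.
Hypothesis s_ge0 : forall n, 0 <= s n.
Hypothesis sM_le : forall m n, (0 < m)%N -> (0 < n)%N ->
  s (m * n) <= n%:R^-1 * (2 * s m) + 2 * s n.
Hypothesis s_divr_le : forall m n, (0 < m)%N -> (0 < n)%N ->
  n%:R^-1 * s m <= 2 * s (m * n) + 2 * s n.
Hypothesis A_gt0 : forall p, A p -> (0 < p)%N.
Local Open Scope ereal_scope.

Let S1 := \esum_(p in A) (s p)%:E.
Let S2 := \esum_(p in A) \esum_(r in F p) (s (p * r))%:E.
Let S3 := \esum_(p in A) \esum_(r in F p) \esum_(u in F r) (s (p * r * u))%:E.

(** The blocks are disjoint subsets of A, so no element of A is counted twice. *)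
Lemma esum_blocks_le (h : nat -> \bar R) : (forall n, 0 <= h n) ->
  \esum_(p in A) \esum_(r in F p) h r <= \esum_(p in A) h p.
Proof.
move=> h0; rewrite -esum_bigcupT //; apply: subset_esum => r [p Ap Fr].
exact: FA Fr.
Qed.

Let E0 n : 0 <= (s n)%:E. Proof. by rewrite lee_fin. Qed.

Lemma weighted_le (c : R) (I : set nat) (b f : nat -> R) :
  (0 <= c)%R -> (forall n, 0 <= f n)%R ->
  \esum_(r in I) (r%:R^-1 : R)%:E <= 2%:E ->
  (forall r, I r -> (b r <= r%:R^-1 * (2 * c) + 2 * f r)%R) ->
  \esum_(r in I) (b r)%:E <= 4%:E * c%:E + 2%:E * \esum_(r in I) (f r)%:E.
Proof.
move=> c0 f0 mass H.
apply: (@le_trans _ _ (\esum_(r in I) ((2 * c)%:E * (r%:R^-1)%:E + 2%:E * (f r)%:E))).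
  by apply: le_esum => r Ir; rewrite -!EFinM -EFinD lee_fin mulrC H.
rewrite esum_linear ?mulr_ge0 //.
apply: leeD => //; rewrite (_ : 4%:E * c%:E = (2 * c)%:E * 2%:E); last first.
  by rewrite -!EFinM; congr EFin; ring.
by apply: lee_wpmul2l => //; rewrite lee_fin mulr_ge0.
Qed.

Let E0' p r : 0 <= \esum_(u in F r) (s (p * u))%:E. Proof. exact: esum_ge0. Qed.
Let E1 r : 0 <= \esum_(u in F r) (s u)%:E. Proof. exact: esum_ge0. Qed.
Let E3 p : 0 <= \esum_(r in F p) \esum_(u in F r) (s (p * r * u))%:E.
Proof. by apply: esum_ge0 => u _; apply: esum_ge0. Qed.
Let E4 p : 0 <= \esum_(r in F p) \esum_(u in F r) (s (r * u))%:E.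
Proof. by apply: esum_ge0 => u _; apply: esum_ge0. Qed.
Let E5 p : 0 <= \esum_(r in F p) \esum_(u in F r) (s u)%:E.
Proof. by apply: esum_ge0 => u _; apply: esum_ge0. Qed.

(** The mass of a block, at most 2, turns the part with s p into 4 S1; disjointness of the blocks
    turns the part with s r into 2 S1. *)
Lemma pairs_le : S2 <= 4%:E * S1 + 2%:E * S1.
Proof.
apply: (@le_trans _ _ (\esum_(p in A) (4%:E * (s p)%:E +
    2%:E * \esum_(r in F p) (s r)%:E))).
  apply: le_esum => p Ap; apply: weighted_le => //; first exact: mass_le2.
  by move=> r Fr; apply: sM_le; apply: A_gt0 => //; apply: FA Fr.
rewrite esum_linear //.
by apply: leeD => //; apply: lee_wpmul2l => //; apply: esum_blocks_le.
Qed.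

Lemma triples_le : S3 <= 4%:E * S2 + 2%:E * S1.
Proof.
apply: (@le_trans _ _ (\esum_(p in A) (4%:E * (\esum_(r in F p) (s (p * r))%:E) +
    2%:E * \esum_(r in F p) \esum_(u in F r) (s u)%:E))).
  apply: le_esum => p Ap; rewrite -(@esum_linear _ _ _ _ _ (fun r => (s (p * r))%:E)) //.
  apply: le_esum => r Fr; have Ar := FA Ap Fr.
  apply: weighted_le => //; first exact: mass_le2.
  move=> u Fu; apply: sM_le; rewrite ?muln_gt0 ?A_gt0 //.
  exact: FA Fu.
rewrite esum_linear //.
apply: leeD => //; apply: lee_wpmul2l => //.
by apply: le_trans (esum_blocks_le E0); apply: esum_blocks_le.
Qed.

(* p is the quotient of p r u by r u. *)
Lemma singles_le : S1 <= 2%:E * S3 + 2%:E * S2.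
Proof.
(* A block has mass at least 1, so a constant is at most its sum against 1 / r over the block. Doing
   this for r and then for u produces the weight 1 / (r u) that [s_divr_le] needs. *)
have expand (c : R) p : A p -> (0 <= c)%R ->
    c%:E <= \esum_(r in F p) (r%:R^-1 * c)%:E.
  move=> Ap c0; apply: (@le_trans _ _ (c%:E * \esum_(r in F p) (r%:R^-1 : R)%:E)).
    by rewrite lee_pemulr ?lee_fin // mass_ge1.
  rewrite -esumZl //.
  by apply: le_esum => r _; rewrite -EFinM mulrC.
apply: (@le_trans _ _ (\esum_(p in A) (2%:E * (\esum_(r in F p) \esum_(u in F r)
    (s (p * r * u))%:E) + 2%:E * \esum_(r in F p) \esum_(u in F r) (s (r * u))%:E))).
  apply: le_esum => p Ap; apply: (le_trans (expand _ p Ap (s_ge0 p))).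
  rewrite -(@esum_linear _ _ _ _ _ (fun r => \esum_(u in F r) (s (p * r * u))%:E)) //.
  apply: le_esum => r Fr; have Ar := FA Ap Fr.
  have sr0 : (0 <= r%:R^-1 * s p)%R by rewrite mulr_ge0 // invr_ge0.
  apply: (le_trans (expand _ r Ar sr0)).
  rewrite -(@esum_linear _ _ _ _ _ (fun u => (s (p * r * u))%:E)) //.
  apply: le_esum => u Fu; have Au := FA Ar Fu.
  rewrite -!EFinM -EFinD lee_fin mulrA -invfM -natrM mulnC -mulnA.
  by apply: s_divr_le; rewrite ?muln_gt0 ?A_gt0.
rewrite esum_linear //.
by apply: leeD => //; apply: lee_wpmul2l => //; apply: esum_blocks_le.
Qed.

Lemma singles_finite_iff : S1 < +oo <-> S2 < +oo /\ S3 < +oo.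
Proof.
have scale (c : R) (x : \bar R) : x < +oo -> 0 <= x -> c%:E * x < +oo.
  by case: x => // r _ _; rewrite -EFinM ltry.
have S10 : 0 <= S1 by rewrite esum_ge0.
have S20 : 0 <= S2 by rewrite esum_ge0 // => p _; rewrite esum_ge0.
have S30 : 0 <= S3.
  by rewrite esum_ge0 // => p _; rewrite esum_ge0 // => r _; rewrite esum_ge0.
split=> [h1|[h2 h3]]; last first.
  by apply: (le_lt_trans singles_le); apply: lte_add_pinfty; apply: scale.
have h2 : S2 < +oo.
  by apply: (le_lt_trans pairs_le); apply: lte_add_pinfty; apply: scale.
by split=> //; apply: (le_lt_trans triples_le); apply: lte_add_pinfty; apply: scale.
Qed.

End pairs_and_triples.

(** * Disjoint blocks in a set with divergent sum of reciprocals *)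

Section blocks.
Variable R : realType.
Implicit Types (A : set nat) (c d m n : nat).

Lemma invn_le1 n : (n%:R^-1 : R) <= 1.
Proof.
by case: n => [|n]; [rewrite invr0 | rewrite invf_le1 ?ltr0n // ler1n].
Qed.

Lemma esum_nat_interval A (f : nat -> R) c d : (forall n, 0 <= f n) ->
  \esum_(i in A `&` [set i | (c <= i < d)%N]) (f i)%:E =
  (\sum_(c <= i < d | i \in A) f i)%:E.
Proof.
move=> f0; have -> : A `&` [set i | (c <= i < d)%N] =
    [set` [seq i <- index_iota c d | i \in A]].
  apply/seteqP; split=> i /=; rewrite mem_filter mem_index_iota.
    by move=> [Ai ->]; rewrite mem_set.
  by move=> /andP[/set_mem Ai ->].
rewrite esum_fset; [|exact: finite_seq|by move=> i _; rewrite lee_fin].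
by rewrite -fsbig_seq ?filter_uniq ?iota_uniq // big_filter sumEFin.
Qed.

(** Divergence makes the sum reach 1; at the least such d it is at most 2, because the last term is
    at most 1. *)
Lemma block_exists A c : ~ (\esum_(i in A) (i%:R^-1 : R)%:E < +oo)%E ->
  exists2 d, (c < d)%N & 1 <= \sum_(c <= i < d | i \in A) (i%:R^-1 : R) <= 2.
Proof.
move=> div; pose u d : R := \sum_(c <= i < d | i \in A) i%:R^-1.
have u0 b d : 0 <= \sum_(b <= i < d | i \in A) (i%:R^-1 : R).
  by apply: sumr_ge0 => i _; rewrite invr_ge0.
have exd : exists d, 1 <= u d.
  apply: contrapT => none; apply: div.
  apply: (@le_lt_trans _ _ (\sum_(0 <= i < c | i \in A) (i%:R^-1 : R) + 1)%:E);
    last exact: ltry.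
  apply: nat_esum_le => [i|n]; first by rewrite lee_fin invr_ge0.
  rewrite sumEFin lee_fin.
  apply: (@le_trans _ _ (\sum_(0 <= i < maxn n c | i \in A) (i%:R^-1 : R))).
    by rewrite [leRHS](@big_cat_nat _ _ _ n) ?leq_maxl //= lerDl u0.
  rewrite (@big_cat_nat _ _ _ c) ?leq_maxr //= lerD2l leNgt; apply/negP => H.
  by apply: none; exists (maxn n c); apply: ltW.
have [d d1 dmin] := ex_minnP exd.
have cd : (c < d)%N.
  by rewrite ltnNge; apply/negP => dc; move: d1; rewrite /u big_geq // leNgt ltr01.
exists d => //; rewrite -/(u d) d1 /=.
have ud : u d.-1 < 1.
  rewrite ltNge; apply/negP => /dmin; rewrite leqNgt.
  by case: d cd {d1 dmin} => // d; rewrite ltnSn.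
case: d cd d1 dmin ud => // d cd d1 _ /= ud.
rewrite /u big_mkcond big_nat_recr //= -big_mkcond /= -/(u d).
by have := invn_le1 d; case: ifP => _; lra.
Qed.

Lemma blocks_exist A (T : nat -> nat) :
  ~ (\esum_(i in A) (i%:R^-1 : R)%:E < +oo)%E ->
  exists F : nat -> set nat, [/\ trivIset setT F, (forall m, F m `<=` A),
    (forall m r, F m r -> (m < r)%N /\ (T m <= r)%N) &
    (forall m, (1 <= \esum_(r in F m) (r%:R^-1 : R)%:E <= 2%:E)%E)].
Proof.
move=> div.
have /choice[D HD] c : exists d, (c < d)%N /\
    1 <= \sum_(c <= i < d | i \in A) (i%:R^-1 : R) <= 2.
  by have [d cd H] := block_exists c div; exists d.
(* [c m] is the left end of block m: past the end of the previous block for disjointness, at least T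
   m, and above m. *)
pose c := fix c m := if m is k.+1 then maxn (D (c k)) (maxn (T k.+1) k.+2)
                     else maxn (T 0%N) 1.
have cT m : (T m <= c m)%N by case: m => [|m] /=; lia.
have cm m : (m < c m)%N by case: m => [|m] /=; lia.
have cD m n : (m < n)%N -> (D (c m) <= c n)%N.
  elim: n => // n IH; rewrite ltnS leq_eqVlt => /orP[/eqP->|mn] /=; first by lia.
  by have := IH mn; have [] := HD (c n); lia.
exists (fun m => A `&` [set i | (c m <= i < D (c m))%N]); split.
- move=> m n _ _ [i [[_ /= im] [_ /= i_n]]].
  by have [mn|mn|//] := ltngtP m n; have := cD _ _ mn; lia.
- by move=> m; apply: subIsetl.
- by move=> m r [_ /= rm]; have := cT m; have := cm m; lia.
- move=> m; rewrite esum_nat_interval => [|n]; last by rewrite invr_ge0.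
  by rewrite !lee_fin; have [] := HD (c m).
Qed.

End blocks.

(** * Products of two and three primes *)

Lemma primes_prod (s : seq nat) : sorted ltn s -> all prime s ->
  primes (\prod_(i <- s) i) = s.
Proof.
move=> srt /allP pr; apply: (irr_sorted_eq ltn_trans ltnn) => //.
  exact: sorted_primes.
elim: s pr {srt} => [|a s IH] pr p; first by rewrite big_nil.
have pa := pr a (mem_head _ _).
have ps i : i \in s -> prime i by move=> is_; apply: pr; rewrite in_cons is_ orbT.
have gt0 : (0 < \prod_(i <- s) i)%N.
  by rewrite big_seq; apply: prodn_cond_gt0 => i /ps /prime_gt0.
rewrite big_cons (primesM _ (prime_gt0 pa) gt0) (primes_prime pa) mem_seq1 in_cons.
by rewrite (IH ps).
Qed.

Section products.
Variable R : realType.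
Variables (A : set nat) (F : nat -> set nat).
Hypothesis A_prime : forall p, A p -> prime p.
Hypothesis FA : forall p, F p `<=` A.
Hypothesis F_gt : forall p r, F p r -> (p < r)%N.

Definition pair_products : set nat := [set k.1 * k.2 | k in A `*`` F]%N.
Definition triple_products : set nat :=
  [set k.1.1 * k.1.2 * k.2 | k in (A `*`` F) `*`` (fun k => F k.2)]%N.

(** As the factors increase, [primes] returns them in order; hence a product determines its factors,
    and sums over products become iterated sums. *)
Lemma primes_pair p r : A p -> F p r -> primes (p * r) = [:: p; r].
Proof.
move=> Ap Fr; rewrite -[RHS]primes_prod ?big_cons ?big_nil ?muln1 //=.
  by rewrite F_gt.
by rewrite !A_prime //; apply: FA Fr.
Qed.

Lemma primes_triple p r u : A p -> F p r -> F r u ->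
  primes (p * r * u) = [:: p; r; u].
Proof.
move=> Ap Fr Fu; rewrite -[RHS]primes_prod ?big_cons ?big_nil ?muln1 ?mulnA //=.
  by rewrite !F_gt.
by rewrite (A_prime Ap) (A_prime (FA Fr)) (A_prime (FA Fu)).
Qed.

Lemma esum_pair_products (f : nat -> \bar R) : (forall n, 0 <= f n)%E ->
  \esum_(n in pair_products) f n = \esum_(p in A) \esum_(r in F p) f (p * r)%N.
Proof.
move=> f0; rewrite esum_esum // esum_image // => -[p r] [p' r'].
rewrite !inE => -[/= Ap Fr] [/= Ap' Fr'] E.
by have := primes_pair Ap Fr; rewrite E primes_pair // => -[-> ->].
Qed.

Lemma esum_triple_products (f : nat -> \bar R) : (forall n, 0 <= f n)%E ->
  \esum_(n in triple_products) f n =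
  \esum_(p in A) \esum_(r in F p) \esum_(u in F r) f (p * r * u)%N.
Proof.
move=> f0; rewrite esum_esum => [|p r _ _]; last exact: esum_ge0.
rewrite esum_esum // esum_image // => -[[p r] u] [[p' r'] u'].
rewrite !inE => -[/= [/= Ap Fr] Fu] [/= [/= Ap' Fr'] Fu'] E.
by have := primes_triple Ap Fr Fu; rewrite E primes_triple // => -[-> -> ->].
Qed.

Lemma products_gt0 n : (pair_products `|` triple_products) n -> (0 < n)%N.
Proof.
case=> [[[p r] [/= Ap Fr] <-]|[[[p r] u] [/= [/= Ap Fr] Fu] <-]].
  by rewrite muln_gt0 !prime_gt0 //; apply: A_prime => //; apply: FA Fr.
by rewrite !muln_gt0 (prime_gt0 (A_prime Ap)) (prime_gt0 (A_prime (FA Fr)))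
  (prime_gt0 (A_prime (FA Fu))).
Qed.

(** After dropping the factor 1 / p, each block sum costs at most 2, so pairs and triples give at
    most 2 and 4 times the sum of 2^-p. *)
Lemma esum_products_damped (w : nat -> R) :
  (forall n, 0 <= w n) ->
  (forall p, (\esum_(r in F p) (r%:R^-1 : R)%:E <= 2%:E)%E) ->
  (forall p r k, A p -> F p r -> (0 < k)%N ->
     w (p * r * k)%N <= (p * r * k)%:R^-1 * 2^-1 ^+ p) ->
  (\esum_(n in pair_products `|` triple_products) (w n)%:E < +oo)%E.
Proof.
move=> w0 mass H.
have w0' n : (0 <= (w n)%:E)%E by rewrite lee_fin.
apply: (le_lt_trans (esumU_le _ _ w0')).
have half0 n : (0 <= ((2^-1 : R) ^+ n)%:E)%E by rewrite lee_fin exprn_ge0.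
have half0' n : 0 <= (2^-1 : R) ^+ n by rewrite exprn_ge0.
have i0 n : (0 <= (n%:R^-1 : R)%:E)%E by rewrite lee_fin invr_ge0.
have fin : (\esum_(p in A) ((2^-1 : R) ^+ p)%:E < +oo)%E.
  by apply: le_lt_trans (esum_halves R); apply: subset_esum.
have fin2 (c : R) : 0 <= c -> (\esum_(p in A) (c%:E * ((2^-1 : R) ^+ p)%:E) < +oo)%E.
  move=> c0; rewrite esumZl //.
  move: fin (esum_ge0 (fun p _ => half0 p) : (0 <= \esum_(p in A) _)%E).
  by case: (\esum_(p in A) _)%E => // x _ _; rewrite -EFinM ltry.
have inner (c : R) p : 0 <= c -> (\esum_(r in F p) (c * r%:R^-1)%:E <= (c * 2)%:E)%E.
  move=> c0; under eq_esum do rewrite EFinM.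
  by rewrite esumZl // EFinM; apply: lee_wpmul2l; rewrite ?lee_fin.
rewrite esum_pair_products // esum_triple_products //.
have inv_half (a b c : nat) : (a * b)%:R^-1 * (2^-1 : R) ^+ c <= 2^-1 ^+ c * b%:R^-1.
  rewrite mulrC ler_wpM2l // natrM invfM ler_piMl ?invr_ge0 //.
  exact: invn_le1.
apply: lte_add_pinfty.
  apply: le_lt_trans (fin2 2 _) => //; apply: le_esum => p Ap.
  rewrite -EFinM [2 * _]mulrC; apply: le_trans (inner _ p (half0' p)).
  apply: le_esum => r Fr; rewrite lee_fin -[(p * r)%N]muln1.
  by apply: (le_trans (H p r 1%N Ap Fr isT)); rewrite muln1.
apply: le_lt_trans (fin2 4 _) => //; apply: le_esum => p Ap.
have half2 : 0 <= (2^-1 : R) ^+ p * 2 by rewrite mulr_ge0.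
rewrite -EFinM (_ : 4 * _ = 2^-1 ^+ p * 2 * 2); last by ring.
apply: le_trans (inner _ p half2); apply: le_esum => r Fr.
have rhalf : 0 <= (2^-1 : R) ^+ p * r%:R^-1 by rewrite mulr_ge0 // invr_ge0.
rewrite mulrAC; apply: le_trans (inner _ r rhalf); apply: le_esum => u Fu.
have u0 : (0 < u)%N by rewrite (leq_trans _ (F_gt Fu)).
rewrite lee_fin; apply: (le_trans (H p r u Ap Fr u0)).
rewrite -mulnA natrM invfM; apply: (@le_trans _ _ ((r * u)%:R^-1 * 2^-1 ^+ p)).
  rewrite -mulrA ler_piMl ?mulr_ge0 ?invr_ge0 //.
  exact: invn_le1.
by rewrite natrM invfM mulrC mulrA.
Qed.

End products.

(** * The terms sin^2 (t log n / 2) / n *)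

Section sine_estimates.
Variable R : realType.
Implicit Types x y t : R.

(** The inequality (a + b)^2 <= 2 a^2 + 2 b^2 in the addition formula, with cos^2 <= 1. *)
Lemma sin_sqr_subadditive x y : sin (x + y) ^+ 2 <= 2 * sin x ^+ 2 + 2 * sin y ^+ 2.
Proof.
rewrite sinD; have := cos2Dsin2 x; have := cos2Dsin2 y.
set a := sin x; set b := sin y; set c := cos x; set d := cos y => h1 h2.
have s1 := sqr_ge0 (a * d - c * b).
have s2 : a ^+ 2 * d ^+ 2 <= a ^+ 2 by rewrite ler_piMr ?sqr_ge0 //; have := sqr_ge0 b; lra.
have s3 : c ^+ 2 * b ^+ 2 <= b ^+ 2 by rewrite ler_piMl ?sqr_ge0 //; have := sqr_ge0 a; lra.
move: s1; rewrite sqrrB !exprMn => s1.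
by rewrite sqrrD !exprMn; lra.
Qed.

Lemma sin_sqr_le x : sin x ^+ 2 <= x ^+ 2.
Proof.
wlog x0 : x / 0 <= x.
  move=> H; have [|/ltW x0] := leP 0 x; first exact: H.
  by have := H (- x); rewrite sinN !sqrrN oppr_ge0; apply.
have [c _] : exists2 c, c \in `[0, x] & sin x - sin 0 = cos c * (x - 0).
  apply: MVT_segment => //.
  by apply/continuous_subspaceT; exact: continuous_sin.
by rewrite sin0 !subr0 => ->; rewrite exprMn ler_piMl ?sqr_ge0.
Qed.

Definition sine_term t (n : nat) : R := n%:R^-1 * sin (t * ln n%:R / 2) ^+ 2.

Lemma sine_term_ge0 t n : 0 <= sine_term t n.
Proof. by rewrite mulr_ge0 ?invr_ge0 // sqr_ge0. Qed.

Lemma sine_termM_le t m n : (0 < m)%N -> (0 < n)%N ->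
  sine_term t (m * n) <= n%:R^-1 * (2 * sine_term t m) + 2 * sine_term t n.
Proof.
move=> m0 n0; rewrite /sine_term natrM invfM lnM ?posrE ?ltr0n // mulrDr mulrDl.
have := sin_sqr_subadditive (t * ln m%:R / 2) (t * ln n%:R / 2).
set S := sin _ ^+ 2; set Sm := sin _ ^+ 2; set Sn := sin _ ^+ 2 => H.
have m1 := invn_le1 R m; have mi : 0 <= m%:R^-1 :> R by rewrite invr_ge0.
have ni : 0 <= n%:R^-1 :> R by rewrite invr_ge0.
have Sn0 : 0 <= Sn by apply: sqr_ge0.
move: (m%:R^-1) (n%:R^-1) m1 mi ni => a b a1 a0 b0.
have h1 : a * b * S <= a * b * (2 * Sm + 2 * Sn) by rewrite ler_wpM2l // mulr_ge0.
have h2 : a * (b * Sn) <= b * Sn by rewrite ler_piMl // mulr_ge0.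
lra.
Qed.

(** Subadditivity applied to ln m = ln (m n) - ln n. *)
Lemma sine_term_divr_le t m n : (0 < m)%N -> (0 < n)%N ->
  n%:R^-1 * sine_term t m <= 2 * sine_term t (m * n) + 2 * sine_term t n.
Proof.
move=> m0 n0; rewrite /sine_term natrM invfM lnM ?posrE ?ltr0n //.
have := sin_sqr_subadditive (t * (ln m%:R + ln n%:R) / 2) (- (t * ln n%:R / 2)).
rewrite (_ : _ + - _ = t * ln m%:R / 2); last by ring.
rewrite sinN sqrrN.
set Sm := sin _ ^+ 2; set S := sin _ ^+ 2; set Sn := sin _ ^+ 2 => H.
have m1 := invn_le1 R m; have mi : 0 <= m%:R^-1 :> R by rewrite invr_ge0.
have ni : 0 <= n%:R^-1 :> R by rewrite invr_ge0.
have Sn0 : 0 <= Sn by apply: sqr_ge0.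
move: (m%:R^-1) (n%:R^-1) m1 mi ni => a b a1 a0 b0.
have h1 : a * b * Sm <= a * b * (2 * S + 2 * Sn) by rewrite ler_wpM2l // mulr_ge0.
have h2 : a * (b * Sn) <= b * Sn by rewrite ler_piMl // mulr_ge0.
lra.
Qed.

(** Meant for x and y equal to ln n and ln (q_n^beta), in either order: the difference enters
    through |sin z| <= |z|, and the weights differ by a factor at most e. *)
Lemma sine_term_perturb t x y : `|y - x| <= 1 ->
  expR (- y) * sin (t * y / 2) ^+ 2 <=
  2 * expR 1 * (expR (- x) * sin (t * x / 2) ^+ 2) +
  expR 1 * t ^+ 2 * (expR (- x) * (y - x) ^+ 2).
Proof.
rewrite ler_norml => /andP[xy _].
have e1 : expR (- y) <= expR 1 * expR (- x) by rewrite -expRD ler_expR; lra.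
have := sin_sqr_subadditive (t * x / 2) (t * (y - x) / 2).
rewrite -mulrDl -mulrDr subrKC.
have := sin_sqr_le (t * (y - x) / 2).
set Sy := sin (t * y / 2) ^+ 2; set Sx := sin (t * x / 2) ^+ 2.
set Sd := sin _ ^+ 2 => h1 h2.
have Sy0 : 0 <= Sy by apply: sqr_ge0.
have h3 : (t * (y - x) / 2) ^+ 2 <= t ^+ 2 * (y - x) ^+ 2 / 2.
  rewrite (_ : _ ^+ 2 = t ^+ 2 * (y - x) ^+ 2 / 4); last by field.
  have : 0 <= t ^+ 2 * (y - x) ^+ 2 by rewrite mulr_ge0 ?sqr_ge0.
  by lra.
apply: (@le_trans _ _ (expR 1 * expR (- x) * (2 * Sx + t ^+ 2 * (y - x) ^+ 2))).
  by apply: ler_pM; rewrite ?expR_ge0 //; lra.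
by rewrite le_eqVlt; apply/orP; left; apply/eqP; ring.
Qed.

End sine_estimates.

(** * Transfer to beta-powers *)

Section transfer.
Variable R : realType.

Lemma G_image (I : set nat) (f : nat -> R) (t : R) : {in I &, injective f} ->
  G_ (f @` I) t <->
  (\esum_(n in I) ((f n)^-1 * sin (t * ln (f n) / 2) ^+ 2)%:E < +oo)%E.
Proof. by move=> finj; rewrite /G_ /= esum_image. Qed.

Lemma G_set0 : G_ set0 = setT :> set R.
Proof. by apply/seteqP; split=> // t _; rewrite /G_ /= esum_set0 ltry. Qed.

Lemma G_summable (A : set nat) : (\esum_(i in A) (i%:R^-1 : R)%:E < +oo)%E ->
  G_ ((fun n => n%:R : R) @` A) = setT.
Proof.
move=> fin; apply/seteqP; split=> // t _; apply/G_image.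
  by move=> m n _ _ /eqP; rewrite eqr_nat => /eqP.
apply: le_lt_trans fin; apply: le_esum => n _.
by rewrite lee_fin ler_piMr ?invr_ge0.
Qed.

Lemma esum_le_affine_finite (I : set nat) (f g w : nat -> R) (c d : R) :
  0 <= c -> 0 <= d -> (forall n, 0 <= g n) -> (forall n, 0 <= w n) ->
  (forall n, I n -> f n <= c * g n + d * w n) ->
  (\esum_(n in I) (g n)%:E < +oo)%E -> (\esum_(n in I) (w n)%:E < +oo)%E ->
  (\esum_(n in I) (f n)%:E < +oo)%E.
Proof.
move=> c0 d0 g0 w0 H gfin wfin.
apply: (@le_lt_trans _ _ (\esum_(n in I) (c%:E * (g n)%:E + d%:E * (w n)%:E))%E).
  by apply: le_esum => n In; rewrite -!EFinM -EFinD lee_fin H.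
rewrite esum_linear //.
have scale (a : R) (x : \bar R) : (x < +oo -> 0 <= x -> a%:E * x < +oo)%E.
  by case: x => // r _ _; rewrite -EFinM ltry.
by apply: lte_add_pinfty; apply: scale => //; apply: esum_ge0 => n _; rewrite lee_fin.
Qed.

(** [sine_term_perturb], used in both directions, bounds each series by a multiple of the other plus
    a multiple of the summable squared errors. *)
Lemma G_perturb (beta : R) (q : nat -> nat) (I : set nat) (t : R) :
  0 < beta -> injective q -> (forall n, prime (q n)) ->
  (forall n, I n -> (0 < n)%N) ->
  (forall n, I n -> `|beta * ln (q n)%:R - ln n%:R| <= 1) ->
  (\esum_(n in I) (n%:R^-1 * (beta * ln (q n)%:R - ln n%:R) ^+ 2)%:E < +oo)%E ->
  G_ ((fun n => (q n)%:R `^ beta) @` I) t <->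
  (\esum_(n in I) (sine_term t n)%:E < +oo)%E.
Proof.
move=> b0 qinj qpr Ipos err werr.
have q0 n : 0 < (q n)%:R :> R by rewrite ltr0n prime_gt0.
have powE n : (q n)%:R `^ beta = expR (beta * ln (q n)%:R) :> R.
  by rewrite /powR gt_eqF.
rewrite G_image; last first.
  move=> m n _ _ /(powR_injective b0); rewrite !nnegrE !ler0n => /(_ isT isT).
  by move=> /eqP; rewrite eqr_nat => /eqP /qinj.
have termE n : ((q n)%:R `^ beta)^-1 * sin (t * ln ((q n)%:R `^ beta) / 2) ^+ 2 =
    expR (- (beta * ln (q n)%:R)) * sin (t * (beta * ln (q n)%:R) / 2) ^+ 2 :> R.
  by rewrite powE -expRN expRK.
have sE n : I n -> sine_term t n = expR (- ln n%:R) * sin (t * ln n%:R / 2) ^+ 2.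
  by move=> /Ipos n0; rewrite /sine_term expRN lnK // posrE ltr0n.
have wE n : I n -> n%:R^-1 = expR (- ln n%:R) :> R.
  by move=> /Ipos n0; rewrite expRN lnK // posrE ltr0n.
have E0 : 0 <= expR (1 : R) := expR_ge0 _.
have w0 n : 0 <= n%:R^-1 * (beta * ln (q n)%:R - ln n%:R) ^+ 2.
  by rewrite mulr_ge0 ?invr_ge0 ?sqr_ge0.
under eq_esum do rewrite termE.
split=> fin.
(* In this direction the squared error comes weighted by q_n^-beta, which is at most e / n; hence
   the second [expR 1]. *)
- apply: (@esum_le_affine_finite _ _ _ _ (2 * expR 1) (expR 1 * expR 1 * t ^+ 2)
    _ _ _ w0 _ fin werr).
  + by rewrite mulr_ge0.
  + by rewrite mulr_ge0 ?sqr_ge0 // mulr_ge0.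
  + by move=> n; rewrite mulr_ge0 ?expR_ge0 ?sqr_ge0.
  move=> n In; rewrite (sE n In) (wE n In).
  have err' : `|ln n%:R - beta * ln (q n)%:R| <= 1 by rewrite distrC err.
  apply: (le_trans (sine_term_perturb t err')); rewrite lerD2l.
  rewrite -[ln n%:R - _]opprB sqrrN; set D := (beta * _ - _) ^+ 2.
  rewrite (_ : expR 1 * expR 1 * t ^+ 2 * _ =
    expR 1 * t ^+ 2 * (expR 1 * expR (- ln n%:R) * D)); last by ring.
  rewrite ler_wpM2l //; first by rewrite mulr_ge0 ?sqr_ge0.
  rewrite ler_wpM2r ?sqr_ge0 // -expRD ler_expR.
  by move: (err n In); rewrite ler_norml => /andP[]; lra.
apply: (@esum_le_affine_finite _ _ _ _ (2 * expR 1) (expR 1 * t ^+ 2)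
    _ _ (sine_term_ge0 t) w0 _ fin werr).
- by rewrite mulr_ge0.
- by rewrite mulr_ge0 ?sqr_ge0.
by move=> n In; rewrite (sE n In) (wE n In); apply: sine_term_perturb; apply: err.
Qed.

End transfer.

Theorem theorem3p6 (R : realType) (G : set R)
    (subgroupG : zmod_closed (mem G)) (reprG : representable G)
    (beta : R) (beta_gt0 : 0 < beta) (beta_lt1 : beta < 1) :
  beta_representable beta G.
Proof.
have [A0 A0P ->] := reprG.
pose A := [set p : nat | prime p /\ A0 p%:R].
have A0E : A0 = (fun p => p%:R) @` A.
  apply/seteqP; split=> [x A0x|_ [p [_ Ap] <-]] //.
  have [p pp px] := A0P x A0x; rewrite powRr1 // in px.
  by exists p => //; split=> //; rewrite px.
have [fin|div] := pselect (\esum_(i in A) (i%:R^-1 : R)%:E < +oo)%E.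
  by exists set0 => //; rewrite A0E G_summable // G_set0.
have [q [qinj qpr qerr]] := prime_injection beta_gt0 beta_lt1.
have half0 m : 0 < (2^-1 : R) ^+ m by rewrite exprn_gt0.
(* Past [T m] the error is at most 2^-m. The block of p lies beyond T p, so on all multiples p r k
   the error is at most 2^-p. *)
have /choice[T HT] m := qerr _ (half0 m).
have [F [trivF FA FT mass]] := blocks_exist T div.
have A_prime p : A p -> prime p by case.
have A_gt0 p : A p -> (0 < p)%N by move=> /A_prime/prime_gt0.
have F_gt p r : F p r -> (p < r)%N by move=> /FT[].
pose N := pair_products A F `|` triple_products A F.
have Npos n : N n -> (0 < n)%N by apply: products_gt0.
pose err n : R := beta * ln (q n)%:R - ln n%:R.
have err_le p r k : A p -> F p r -> (0 < k)%N ->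
    `|err (p * r * k)%N| <= 2^-1 ^+ p.
  move=> Ap Fr k0; apply: HT; have [_ Tr] := FT _ _ Fr.
  by rewrite (leq_trans Tr) // mulnAC leq_pmull // muln_gt0 A_gt0.
have err1 n : N n -> `|err n| <= 1.
  have half1 p : (2^-1 : R) ^+ p <= 1 by rewrite exprn_ile1 // invf_le1 // ler1n.
  case=> [[[p r] [/= Ap Fr] <-]|[[[p r] u] [/= [/= Ap Fr] Fu] <-]].
    by apply: le_trans (half1 p); rewrite -[(p * r)%N]muln1 err_le.
  by apply: le_trans (half1 p); rewrite err_le // (A_gt0 _ (FA _ _ Fu)).
have mass_le p : (\esum_(r in F p) (r%:R^-1 : R)%:E <= 2%:E)%E.
  by have /andP[] := mass p.
have mass_ge p : (1 <= \esum_(r in F p) (r%:R^-1 : R)%:E)%E.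
  by have /andP[] := mass p.
have werr : (\esum_(n in N) (n%:R^-1 * err n ^+ 2)%:E < +oo)%E.
  apply: (esum_products_damped A_prime FA F_gt) => // [n|p r k Ap Fr k0].
    by rewrite mulr_ge0 ?invr_ge0 ?sqr_ge0.
  rewrite ler_wpM2l ?invr_ge0 // -real_normK ?num_real //.
  have e1 := err_le p r k Ap Fr k0.
  (* One factor of the square is at most 1, which leaves the other, at most 2^-p. *)
  apply: le_trans e1; rewrite expr2 ler_piMl //.
  apply: le_trans (err_le p r k Ap Fr k0) _.
  by rewrite exprn_ile1 // invf_le1 // ler1n.
exists ((fun n => (q n)%:R `^ beta) @` N).
  by move=> _ [n _ <-]; exists (q n) => //=; apply: qpr.
have injA : {in A &, injective (fun n => n%:R : R)}.
  by move=> m n _ _ /eqP; rewrite eqr_nat => /eqP.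
suff iffG t : G_ A0 t <-> G_ ((fun n => (q n)%:R `^ beta) @` N) t.
  by apply/seteqP; split=> t /iffG.
rewrite A0E (G_image t injA) (G_perturb t beta_gt0 qinj qpr Npos err1 werr).
have s0 n : (0 <= (sine_term t n)%:E)%E by rewrite lee_fin sine_term_ge0.
have finN : (\esum_(n in N) (sine_term t n)%:E < +oo)%E <->
    (\esum_(n in pair_products A F) (sine_term t n)%:E < +oo)%E /\
    (\esum_(n in triple_products A F) (sine_term t n)%:E < +oo)%E.
  split=> [fin|[fin2 fin3]].
    by split; apply: le_lt_trans fin; apply: subset_esum => n; [left|right].
  by apply: (le_lt_trans (esumU_le _ _ s0)); apply: lte_add_pinfty.
rewrite finN esum_pair_products // esum_triple_products //.
apply: singles_finite_iff => //.
- exact: sine_termM_le.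
- exact: sine_term_divr_le.
Qed.
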